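(* Let $X$ be a dendrite, $f:X\to X$ a continuous monotone map and $n\in\mathbb N$. Then the induced map $\mathcal T_n(f):\mathcal T_n(X)\to\mathcal T_n(X)$ has no Li-Yorke pair. In particular, it has zero topological entropy.
   Context: A dendrite is a locally connected continuum (compact connected metric space) containing no simple closed curve. A map is monotone if the preimage of every connected set is connected. $\mathbb N$ denotes the positive integers. An endpoint of a dendrite $Y$ is a point $p$ such that $Y\setminus\{p\}$ is connected and nonempty; a tree is a dendrite with finitely many endpoints; by convention a one-point set is a tree whose only point is its unique endpoint. $2^X$ is the set of nonempty closed subsets of $X$ with the Hausdorff metric $d_H$. $\mathcal T_n(X)\subset 2^X$ is the family of trees contained in $X$ with at most $n$ endpoints; it is a closed subset of $2^X$, mapped into itself by $A\mapsto f(A)$ when $f$ is monotone, and $\mathcal T_n(f)(A)=f(A)$. For a continuous self-map $F$ of a compact metric space $(Y,\rho)$, a pair $(x,y)$ is proximal if $\liminf_{k\to\infty}\rho(F^k(x),F^k(y))=0$, asymptotic if $\limsup_{k\to\infty}\rho(F^k(x),F^k(y))=0$, and a Li-Yorke pair if it is proximal but not asymptotic. Topological entropy is $h(F)=\lim_{\varepsilon\to0}\limsup_{m\to\infty}\frac1m\log \mathrm{sep}(m,F,\varepsilon)$, where $\mathrm{sep}(m,F,\varepsilon)$ is the maximal cardinality of a set $E\subset Y$ such that any two distinct $x,y\in E$ satisfy $\rho(F^j(x),F^j(y))>\varepsilon$ for some $0\le j<m$. *)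

(* Defs.v *)
From HB Require Import structures.
From mathcomp Require Import all_boot all_order all_algebra.
From mathcomp Require Import finmap.
From mathcomp Require Import all_classical all_reals all_analysis.

Set Implicit Arguments.
Unset Strict Implicit.
Unset Printing Implicit Defensive.

Import Order.TTheory GRing.Theory Num.Theory.
Import numFieldNormedType.Exports.

Local Open Scope classical_set_scope.
Local Open Scope ring_scope.

(* Every property of a subset below is that of the subset with its subspace
   topology; a space is the set [set: X] *)

Section continuum_theory.
Context {T : topologicalType}.
Implicit Types (A B C : set T) (p : T).

(* The sets [A `&` W] with [W] open are the relatively open subsets of [A] *)
Definition locally_connected A :=
  forall p U, A p -> open U -> U p ->
  exists W, [/\ open W, W p, A `&` W `<=` U & connected (A `&` W)].

Definition continuum A := [/\ A !=set0, compact A & connected A].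

Definition homeomorphic {U : topologicalType} A (B : set U) :=
  exists (h : T -> U) (g : U -> T),
    [/\ {within A, continuous h}, {within B, continuous g},
        (forall x, A x -> B (h x) /\ g (h x) = x) &
        (forall y, B y -> A (g y) /\ h (g y) = y)].

End continuum_theory.

Definition unit_circle (R : realType) : set (R * R) :=
  [set z | z.1 ^+ 2 + z.2 ^+ 2 = 1].

Definition simple_closed_curve (R : realType) (T : topologicalType)
  (S : set T) := homeomorphic (@unit_circle R) S.

Section dendrites.
Context {R : realType} {X : metricType R}.
Implicit Types (A B Y : set X) (f : X -> X).

Definition dendrite Y :=
  [/\ continuum Y, locally_connected Y &
      ~ exists2 S : set X, simple_closed_curve R S & S `<=` Y].

(* The second alternative is the convention for one-point sets *)
Definition endpoint Y : set X :=
  [set p | Y p /\ ((Y `\ p !=set0 /\ connected (Y `\ p)) \/ Y = [set p])].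

Definition tree Y := dendrite Y /\ finite_set (endpoint Y).

(* Trees are nonempty and compact, so this is a family of points of the
   hyperspace of nonempty closed subsets *)
Definition trees (n : nat) : set (set X) :=
  [set A | tree A /\ (endpoint A #<= `I_n)%card].

Definition monotone_map f :=
  forall C : set X, connected C -> connected (f @^-1` C).

(* On nonempty bounded sets, in particular on the nonempty subsets of a compact
   space, the suprema and infima involved are genuine *)
Definition hausdorff_dist A B : R :=
  Num.max (sup [set inf [set mdist a b | b in B] | a in A])
          (sup [set inf [set mdist a b | a in A] | b in B]).

(* The map induced on sets; it sends [trees n] to itself if [f] is continuous
   and monotone and [X] is a dendrite *)
Definition induced_map f : set X -> set X := fun A => f @` A.

End dendrites.

(* [D] is the phase space, given as a subset of [Y] mapped to itself by [F],
   and [rho] is its metric *)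
Section dynamics.
Context {R : realType} {Y : choiceType}.
Variables (rho : Y -> Y -> R) (F : Y -> Y).
Implicit Types (x y : Y) (D : set Y) (E : {fset Y}).
Local Open Scope ereal_scope.

Definition proximal x y :=
  limn_einf (fun k => (rho (iter k F x) (iter k F y))%:E) = 0.

Definition asymptotic x y :=
  limn_esup (fun k => (rho (iter k F x) (iter k F y))%:E) = 0.

Definition li_yorke_pair x y := proximal x y /\ ~ asymptotic x y.

Definition separated_set (m : nat) (eps : R) E :=
  forall x y, x \in E -> y \in E -> x <> y ->
  exists2 j : nat, (j < m)%N & (eps < rho (iter j F x) (iter j F y))%R.

Definition sep D (m : nat) (eps : R) : \bar R :=
  ereal_sup [set (#|` E|%:R)%:E | E in
    [set E | [set` E] `<=` D /\ separated_set m eps E]].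

Definition entropy_at D (eps : R) : \bar R :=
  limn_esup (fun m : nat => (m%:R^-1)%:E * lne (sep D m eps)).

Definition topological_entropy D : \bar R :=
  lim (entropy_at D eps @[eps --> 0%R^'+]).

Lemma sep_nonincreasing D m (e1 e2 : R) :
  (e1 <= e2)%R -> sep D m e2 <= sep D m e1.
Proof.
move=> e12; apply: ereal_sup_le => _ [E [ED sE] <-]; exists E => //.
split=> // x y xE yE xy; have [j jm ej] := sE x y xE yE xy.
by exists j => //; exact: le_lt_trans ej.
Qed.

Lemma lne_homo (a b : \bar R) : a <= b -> lne a <= lne b.
Proof.
move=> ab; have [a0|a0] := leP a 0; first by rewrite le0_lneNy// leNye.
by rewrite lee_lne// in_itv/= leey ?andbT ltW// (lt_le_trans a0).
Qed.

Lemma entropy_at_nonincreasing D (e1 e2 : R) :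
  (e1 <= e2)%R -> entropy_at D e2 <= entropy_at D e1.
Proof.
move=> e12; apply: le_ereal_inf_tmp => _ [V FV <-].
apply: le_trans (_ : ereal_sup [set (m%:R^-1)%:E * lne (sep D m e2) | m in V]
   <= _).
  by apply: ereal_inf_lbound; exists V.
apply: ge_ereal_sup => _ [m Vm <-].
apply: le_trans (ereal_sup_ubound _); last by exists m.
rewrite lee_wpmul2l// ?lee_fin ?invr_ge0//.
exact/lne_homo/sep_nonincreasing.
Qed.

(* So the limit in [topological_entropy] is never the default value of [lim] *)
Lemma is_cvg_entropy_at D : cvg (entropy_at D eps @[eps --> 0%R^'+]).
Proof.
apply: nonincreasing_at_right_is_cvge; apply: nearW => x e1 e2 _ _ e12.
exact: entropy_at_nonincreasing.
Qed.

End dynamics.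

(* Main.v *)
(** Call a set a halfspace if it and its complement are connected.  In a dendrite,
any two points are joined by a smallest connected set, so one of the four
quadrants cut out by two halfspaces is always empty; and preimages of halfspaces
under a monotone map are halfspaces.  Comparing a halfspace [H] with its preimage
under [f^p] for every [p > 0], this alone forces the set of times [k] with
[f^k x] in [H] to be eventually periodic.  A tree meets a halfspace iff one of its
endpoints lies in it, so the set of times at which the image of a tree meets a
halfspace is eventually periodic too.  Finitely many nested pairs of halfspaces
at positive distance detect all pairs of trees at Hausdorff distance at least
[e]; hence if two orbits of trees are infinitely often [e]-apart, some such pair
separates them along an arithmetic progression of times, which excludes
proximality by uniform continuity.  For the entropy, [m] halfspaces cut the
dendrite into at most [m + 1] cells, so the number of [e]-separated orbit segments
of length [m] grows polynomially in [m].

That a dendrite has enough halfspaces rests on arcs: a path in a connected open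
set is made injective by cutting out its loops, and two arcs with the same ends,
one of them avoiding an interior point of the other, contain a simple closed
curve. *)

Require Import Defs.
From mathcomp Require Import all_boot all_order all_algebra.
From mathcomp Require Import finmap.
From mathcomp Require Import all_classical all_reals all_analysis.
From mathcomp Require Import lra zify.
Set Implicit Arguments.
Unset Strict Implicit.
Unset Printing Implicit Defensive.
Import Order.TTheory GRing.Theory Num.Theory.
Import numFieldNormedType.Exports.
Local Open Scope classical_set_scope.
Local Open Scope ring_scope.

(** * Compactness and chains *)

Section compactness.
Context {T : topologicalType}.

(** Compactness for a family directed downwards instead of a filter. The sets [B i] may fail to be
    closed, hence the closures in the conclusion. Typically [B i] collects counterexamples at scale
    [i], and the common cluster point yields a contradiction. *)
Lemma compact_filter_from (I : Type) (D : set I) (B : I -> set T) (A : set T) :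
  compact A -> D !=set0 ->
  (forall i j, D i -> D j -> exists2 k, D k & B k `<=` B i `&` B j) ->
  (forall i, D i -> (A `&` B i) !=set0) ->
  exists2 p, A p & forall i, D i -> closure (B i) p.
Proof.
move=> cA D0 DB AB.
have FF : Filter (filter_from D (fun i => A `&` B i)).
  apply: filter_from_filter => // i j Di Dj.
  by have [k Dk kij] := DB _ _ Di Dj; exists k => // x [Ax /kij[]].
have PF := filter_from_proper FF AB.
have [|p [Ap cp]] := cA _ PF.
  by have [i Di] := D0; exists i => // x [].
exists p => // i Di; apply: (@closureI _ A (B i) p _).2.
by move=> V Vp; apply: cp => //; exists i.
Qed.

Lemma compact_chain (F : set (set T)) (A : set T) :
  compact A -> F !=set0 -> total_on F subset ->
  (forall K, F K -> closed K) -> (forall K, F K -> (A `&` K) !=set0) ->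
  exists2 p, A p & forall K, F K -> K p.
Proof.
move=> cA F0 tF cF AF.
have [|p Ap Fp] := @compact_filter_from _ F id A cA F0 _ AF.
  move=> K L FK FL; have [KL|LK] := tF _ _ FK FL.
    by exists K => // x Kx; split => //; exact: KL.
  by exists L => // x Lx; split => //; exact: LK.
by exists p => // K FK; apply: cF => //; exact: Fp.
Qed.

Lemma compact_finite_cover (I : choiceType) (D : set I) (f : I -> set T)
    (A : set T) :
  compact A -> (forall i, D i -> open (f i)) ->
  A `<=` \bigcup_(i in D) f i ->
  exists2 E : {fset I}, [set` E] `<=` D & A `<=` \bigcup_(i in [set` E]) f i.
Proof.
move=> cA fo Af; apply: contrapT => nE.
pose J : set {fset I} := [set E | [set` E] `<=` D].
pose B (E : {fset I}) := ~` \bigcup_(i in [set` E]) f i.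
have [|||p Ap Jp] := @compact_filter_from _ J B A cA.
- by exists fset0.
- move=> E1 E2 J1 J2; exists (E1 `|` E2)%fset.
    by move=> i /=; rewrite inE => /orP[/J1|/J2].
  by move=> x nx; split => -[i /= iE fx]; apply: nx; exists i => //=;
    rewrite inE iE ?orbT.
- move=> E JE; apply: contrapT => /nonemptyPn E0; apply: nE.
  exists E => // x Ax; apply: contrapT => nx.
  by have : (A `&` B E) x by []; rewrite E0.
have [i Di fip] := Af _ Ap.
have := Jp [fset i]%fset _ (f i) _; case.
- by move=> j /=; rewrite inE => /eqP ->.
- by apply: open_nbhs_nbhs; split => //; exact: fo.
- by move=> x [nx fx]; apply: nx; exists i => //=; rewrite inE.
Qed.

End compactness.

Section metric_facts.
Context {R : realType} {X : metricType R}.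
Implicit Types (x y p : X) (A U C K : set X) (e : R).
Import metricType_numDomainType.

Lemma nbhs_mdistE p A :
  nbhs p A <-> exists2 e : R, 0 < e & forall y, mdist p y < e -> A y.
Proof. by rewrite -filter_from_mdist_nbhs; split=> -[e e0 H]; exists e. Qed.

Lemma open_mdist U : open U <->
  forall p, U p -> exists2 e : R, 0 < e & forall y, mdist p y < e -> U y.
Proof.
split=> [oU p Up|H]; first exact/nbhs_mdistE/open_nbhs_nbhs.
by rewrite openE => p /H/nbhs_mdistE.
Qed.

Lemma open_mdist_ball p e : open [set y | mdist p y < e].
Proof.
apply/open_mdist => q /= pq; exists (e - mdist p q); first by lra.
by move=> y qy /=; have := metric_triangle p q y; lra.
Qed.

Lemma closed_mdist K : closed K -> forall p, ~ K p ->
  exists2 e : R, 0 < e & forall y, mdist p y < e -> ~ K y.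
Proof. by move=> /closed_openC/open_mdist. Qed.

End metric_facts.

(* Every path below is a map on the whole line, of which only the restriction
   to the unit interval matters *)
Section paths.
Context {R : realType} {X : metricType R}.
Implicit Types (x y p : X) (A U C K : set X) (e : R).

(** A small connected set, not just a small distance: a link can then be refined again by
    [connected_chain]. *)
Definition linked e x y := exists V : set X,
  [/\ connected V, V x, V y & forall u v, V u -> V v -> mdist u v < e].

Hypothesis cX : compact [set: X].
Hypothesis lcX : locally_connected [set: X].

Lemma small_connected e x : 0 < e -> exists W, [/\ open W, W x, connected W &
  forall u v, W u -> W v -> mdist u v < e].
Proof.
move=> e0; have e20 : 0 < e / 2 by lra.
have [//||W [oW Wx]] := lcX (p := x) (U := [set y | mdist x y < e / 2]) I.
- exact: open_mdist_ball.
- by rewrite /= mdistxx.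
rewrite setTI => WU cW; exists W; split=> // u v /WU/= xu /WU/= xv.
have := metric_triangle u x v; rewrite (metric_sym u x); lra.
Qed.

(** Fix a finite cover by small connected open sets. A path without repetition through members that
    meet [U], each meeting the next, is no longer than the cover, so [N] depends on [e] alone. The
    chain stays near [U] but may leave it. *)
Lemma connected_chain e : 0 < e -> exists2 N, (0 < N)%N &
  forall U x y, connected U -> U x -> U y -> exists c : nat -> X,
  [/\ c 0%N = x, c N = y, (forall j, linked e (c j) (c j.+1)) &
      forall j, exists2 u, U u & mdist (c j) u < e].
Proof.
move=> e0.
have /choice[V HV] := fun x => small_connected x e0.
have [//|x _|E _ XE] := @compact_finite_cover _ X setT V setT cX.
- by move=> i _; have [] := HV i.
- by exists x => //; have [] := HV x.
exists (#|` E|).+1 => // U x y cU Ux Uy.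
pose meets (i : E) := V (val i) `&` U !=set0.
pose r (i j : E) := `[< V (val i) `&` V (val j) !=set0 /\ meets j >].
have ex_i z : exists i : E, V (val i) z.
  by have [i /= iE Vz] := XE z I; exists [` iE]%fset.
have [i0 Vi0] := ex_i x.
have mi0 : meets i0 by exists x.
(* Otherwise the members reachable from [i0] and the remaining ones meeting [U] cover [U] by two
   open sets that are disjoint on [U]. *)
have [i1 ri1 Vi1] : exists2 i1 : E, connect r i0 i1 & V (val i1) y.
  apply: contrapT => H.
  pose O := \bigcup_(i in [set i : E | connect r i0 i]) V (val i).
  pose O' := \bigcup_(i in [set i : E | meets i /\ ~ connect r i0 i]) V (val i).
  have oO : open O by apply: bigcup_open => i _; have [] := HV (val i).
  have oO' : open O' by apply: bigcup_open => i _; have [] := HV (val i).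
  have OO' z : U z -> ~ (O z) <-> O' z.
    move=> Uz; split=> [nOz|[j [mj nrj] Vj] [i /= ri Vi]].
      have [i Vi] := ex_i z; exists i => //; split; first by exists z.
      by move=> ri; apply: nOz; exists i.
    apply: nrj; apply: connect_trans ri (connect1 _).
    by apply/asboolP; split => //; exists z.
  have UO : U `&` O = U.
    apply: cU; first by exists x; split => //; exists i0 => //=.
    - by exists O.
    - exists (~` O'); first exact: open_closedC.
      apply/seteqP; split=> z [Uz Oz]; split=> //.
        by move/(OO' z Uz).
      by apply: contrapT => /(OO' z Uz).
  have : (U `&` O) y by rewrite UO.
  by move=> [_ [i /= ri Vi]]; apply: H; exists i.
move: ri1 => /connectP[p0 rp0 i1E].
have [rp up lp] : [/\ path r i0 (shorten i0 p0), uniq (i0 :: shorten i0 p0) &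
    i1 = last i0 (shorten i0 p0)].
  by rewrite i1E; case: (shortenP rp0).
move: (shorten i0 p0) rp up lp => {p0 rp0 i1E} p rp up i1E.
have sp : (size p < #|` E|.+1)%N.
  have := max_card [in i0 :: p]; rewrite (card_uniqP up) /= cardfE => sp.
  by rewrite ltnS ltnW.
(* Past the end of the path the chain rests at [y], which brings its length to exactly [N]. *)
have : exists c : nat -> X, [/\ c 0%N = x,
   (forall j, (size p < j)%N -> c j = y), (forall j, linked e (c j) (c j.+1)) &
      forall j, exists2 u, U u & mdist (c j) u < e].
  elim: p i0 x Vi0 mi0 rp i1E {Ux up sp} => [|i p IH] i0 x Vi0 mi0 /= rp i1E.
    exists (fun j => if j is 0%N then x else y); split => //.
    - by case.
    - move=> j; exists (V (val i1)); have [_ _ cV dV] := HV (val i1).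
      by split => //; case: j => //=; rewrite i1E.
    - by case=> [|j]; [have [u [Vu Uu]] := mi0; exists u => //;
        have [_ _ _ ->] := HV (val i0)|exists y => //; rewrite mdistxx].
  move: rp => /andP[/asboolP[[w [Vi0w Viw]] mi] rp].
  have [c [c0 cy cl cU']] := IH _ _ Viw mi rp i1E.
  exists (fun j => if j is j'.+1 then c j' else x); split => //.
  - by case=> // j; rewrite ltnS; exact: cy.
  - case=> [|j] //; rewrite c0; exists (V (val i0)).
    by have [_ _ ? ?] := HV (val i0).
  - case=> [|j] //; have [u [Vu Uu]] := mi0; exists u => //.
    by have [_ _ _ ->] := HV (val i0).
by move=> [c [c0 cy cl cU']]; exists c; split => //; exact: cy.
Qed.

End paths.

(** * Paths *)

Lemma ltr_normB (R : realType) (x y e : R) :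
  `|x - y| < e -> x < y + e /\ y < x + e.
Proof. by rewrite ltr_distl => /andP[? ?]; split; lra. Qed.

Section line_maps.
Context {R : realType} {X : metricType R}.
Import metricType_numDomainType.

Lemma continuous_lineP (f : R -> X) : continuous f <->
  forall t (e : R), 0 < e -> exists2 d : R, 0 < d &
    forall s, `|t - s| < d -> mdist (f t) (f s) < e.
Proof.
split=> [cf t e e0|H t].
  have /cvgrPdist_lt/(_ e e0)/nbhs_ballP[d d0 H] := cf t.
  by exists d => // s ts; apply: H; rewrite /ball/=.
apply/cvgrPdist_lt => e e0; apply/nbhs_ballP.
by have [d d0 Hd] := H t e e0; exists d => // s ts; apply: Hd.
Qed.

Lemma glue_continuous (f g : R -> X) c : continuous f -> continuous g ->
  f c = g c -> continuous (fun t => if t <= c then f t else g t).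
Proof.
move=> cf cg fg; apply/continuous_lineP => t e e0.
have [df df0 Hf] := (iffLR (continuous_lineP f)) cf t _ e0.
have [dg dg0 Hg] := (iffLR (continuous_lineP g)) cg t _ e0.
have [tc|ct|tc] := ltgtP t c.
- exists (Num.min df (c - t)); first by rewrite lt_min df0 subr_gt0.
  move=> s; rewrite lt_min => /andP[sdf /ltr_normB[_ sc]].
  by rewrite ifT; [exact: Hf|lra].
- exists (Num.min dg (t - c)); first by rewrite lt_min dg0 subr_gt0.
  move=> s; rewrite lt_min => /andP[sdg /ltr_normB[sc _]].
  by rewrite ifF; [exact: Hg|apply/negbTE; rewrite -ltNge; lra].
- exists (Num.min df dg); first by rewrite lt_min df0.
  move=> s; rewrite lt_min => /andP[sf sg].
  by case: ifP => _; [exact: Hf|rewrite tc fg -tc; exact: Hg].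
Qed.

Lemma path_cat (U : set X) (f g : R -> X) :
  continuous f -> continuous g -> f 1 = g 0 ->
  (forall t, U (f t)) -> (forall t, U (g t)) ->
  exists h : R -> X,
    [/\ continuous h, h 0 = f 0, h 1 = g 1 & forall t, U (h t)].
Proof.
move=> cf cg fg Uf Ug.
exists (fun t => if t <= 2^-1 then f (2 * t) else g (2 * t - 1)); split.
- apply: (@glue_continuous (fun t => f (2 * t)) (fun t => g (2 * t - 1))).
  + by move=> t; apply: continuous_comp; [exact: mulrl_continuous|exact: cf].
  + move=> t; apply: continuous_comp; last exact: cg.
    by apply: cvgB; [exact: mulrl_continuous|exact: cvg_cst].
  + by rewrite divff// subrr.
- by rewrite ifT ?invr_ge0// mulr0.
- rewrite ifF ?mulr1; last by apply/negbTE; rewrite -ltNge; lra.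
  by congr g; lra.
- by move=> t; case: ifP.
Qed.

(** In a grid refined [N] times, the fine cell of a point determines its coarse cell. Negative
    points lie in cell 0 of every grid, since [truncn] sends them to 0. *)
Lemma truncn_mulnK (x : R) N : (0 < N)%N ->
  (Num.truncn (x * N%:R) %/ N)%N = Num.truncn x.
Proof.
move=> N0; have N0R : (0 : R) < N%:R by rewrite ltr0n.
have [x0|x0] := ltP x 0.
  have xN : x * N%:R < 0 by rewrite nmulr_rlt0.
  have T0 (z : R) : z < 0 -> Num.truncn z = 0%N.
    by move=> z0; apply/truncn0Pn; rewrite -ltNge (lt_trans z0).
  by rewrite !T0 ?div0n.
have /truncn_itv/andP[] : 0 <= x * N%:R by rewrite mulr_ge0// ltW.
set m := Num.truncn _ => m1 m2; apply/esym/truncn_def/andP; split.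
  rewrite -(ler_pM2r N0R); apply: le_trans m1.
  by rewrite -natrM ler_nat leq_divM.
rewrite -(ltr_pM2r N0R); apply: (lt_le_trans m2).
by rewrite -natrM ler_nat ltn_ceil.
Qed.

Lemma truncn_near (x y : R) : `|x - y| < 1 ->
  [\/ Num.truncn x = Num.truncn y, Num.truncn x = (Num.truncn y).+1 |
      Num.truncn y = (Num.truncn x).+1].
Proof.
move=> xy.
have H (u v : R) : `|u - v| < 1 -> (Num.truncn u <= (Num.truncn v).+1)%N.
  move=> /ltr_normB[uv _]; rewrite truncn_le_nat.
  have := truncnS_gt v; rewrite [in X in _ -> X]mulrSr; lra.
have := H _ _ xy; have := H y x; rewrite distrC => /(_ xy).
have [||] := ltngtP (Num.truncn x) (Num.truncn y) => h1 h2 h3.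
- by apply: Or33; apply/eqP; rewrite eqn_leq h1 h2.
- by apply: Or32; apply/eqP; rewrite eqn_leq h1 h3.
- by apply: Or31.
Qed.

Lemma halves_lt (e eta : R) : 0 < eta -> exists k, e / 2 ^+ k < eta.
Proof.
move=> eta0; have H := truncnS_gt (e / eta).
move: (Num.truncn _).+1 H => k H; exists k.
have K : k%:R < 2 ^+ k :> R by rewrite -natrX ltr_nat ltn_expl.
by rewrite ltr_pdivrMr ?exprn_gt0// mulrC -ltr_pdivrMr// (lt_trans H).
Qed.

End line_maps.

Section path_connectedness.
Context {R : realType} {X : metricType R}.
Implicit Types (x y p : X) (A U C K : set X) (e : R).
Hypothesis cX : compact [set: X].
Hypothesis lcX : locally_connected [set: X].

(** The limit is a cluster point of the tails: compactness does the work of completeness. *)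
Lemma cauchy_halves_lim (u : nat -> X) (e : R) :
  (forall k i, mdist (u k) (u (k + i)%N) <= e / 2 ^+ k) ->
  exists p, forall k, mdist (u k) p <= e / 2 ^+ k.
Proof.
move=> uC.
have [|||p _ Hp] := @compact_filter_from _ nat setT
    (fun n => [set u j | j in [set j | (n <= j)%N]]) setT cX.
- by exists 0%N.
- move=> i j _ _; exists (maxn i j) => // _ [k /= ijk <-].
  by split; exists k => //=; lia.
- by move=> i _; exists (u i); split => //; exists i => //=.
exists p => k; apply/ler_addgt0Pl => eta eta0.
have [//||_ [[j /= kj <-] pj]] := Hp k _ [set y | mdist p y < eta] _.
  by apply: open_nbhs_nbhs; split; [exact: open_mdist_ball|rewrite /= mdistxx].
have := uC k (j - k)%N; rewrite subnKC// => ukj.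
have := metric_triangle (u k) (u j) p; rewrite (metric_sym (u j)).
move: pj => /=; lra.
Qed.

(* [P k] is the chain of scale [e / 2 ^ k], refined at each step by chains of a
   length [N k] which does not depend on the link *)
Lemma linked_path e x y : 0 < e -> linked e x y -> exists g : R -> X,
  [/\ continuous g, g 0 = x, g 1 = y & forall t, mdist x (g t) < 6 * e].
Proof.
move=> e0 lxy; pose d k : R := e / 2 ^+ k.
have d0 k : 0 < d k by rewrite divr_gt0// exprn_gt0.
have dS k : d k = 2 * d k.+1.
  by rewrite /d exprS invfM; have := exprn_gt0 k (ltr0Sn R 1); lra.
have step k : exists Nc : nat * (X -> X -> nat -> X), (0 < Nc.1)%N /\
    forall x y, linked (d k) x y -> [/\ Nc.2 x y 0%N = x, Nc.2 x y Nc.1 = y,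
      forall j, linked (d k.+1) (Nc.2 x y j) (Nc.2 x y j.+1) &
      forall j, mdist x (Nc.2 x y j) < d k + d k.+1].
  have [N N0 HN] := connected_chain cX lcX (d0 k.+1).
  have /choice[c Hc] : forall xy : X * X, exists c : nat -> X,
      linked (d k) xy.1 xy.2 -> [/\ c 0%N = xy.1, c N = xy.2,
      forall j, linked (d k.+1) (c j) (c j.+1) &
      forall j, mdist xy.1 (c j) < d k + d k.+1].
    move=> [a b]/=; have [[V [cV Va Vb dV]]|nl] := pselect (linked (d k) a b);
      last by exists (fun=> a).
    have [c [ca cb lc nc]] := HN _ _ _ cV Va Vb; exists c => _; split=> // j.
    have [u Vu cu] := nc j; have := dV _ _ Va Vu.
    have := metric_triangle a u (c j); rewrite (metric_sym u); lra.
  by exists (N, fun x y => c (x, y)); split=> // a b /(Hc (a, b)).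
have /choice[Nc HNc] := step.
pose N k := (Nc k).1; pose c k := (Nc k).2.
have N0 k : (0 < N k)%N by have [] := HNc k.
(* At level [k.+1], index [b] is position [b %% N k] in the chain refining link [b %/ N k] of level
   [k]; [L k] is the number of links over the unit interval. *)
pose P := fix P k : nat -> X := if k is k'.+1 then
  fun b => c k' (P k' (b %/ N k')%N) (P k' (b %/ N k').+1) (b %% N k')%N
  else fun b => if b is 0%N then x else y.
pose L := fix L k := if k is k'.+1 then (L k' * N k')%N else 1%N.
have L0 k : (0 < L k)%N by elim: k => //= k IH; rewrite muln_gt0 IH N0.
have lP k : forall b, linked (d k) (P k b) (P k b.+1).
  elim: k => [|k IH] b.
    rewrite /d expr0 divr1; case: b => //= b.
    by have [V [cV Vx Vy dV]] := lxy; exists V.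
  have [_ /(_ _ _ (IH (b %/ N k)%N))[_ cN lc _]] := HNc k.
  rewrite /= modnS divnS//; case: ifPn => [dv|_]; last by rewrite add0n; exact: lc.
  (* Here [b.+1] starts a new chain, whose first point is the last point of the chain of [b]. *)
  have rN : (b %% N k).+1 = N k.
    apply/eqP; rewrite eqn_leq ltn_pmod//=; apply: dvdn_leq => //.
    by move: dv; rewrite {1}(divn_eq b (N k)) -addnS dvdn_addr// dvdn_mull.
  have [_ /(_ _ _ (IH (b %/ N k).+1))[c0 _ _ _]] := HNc k.
  by have := lc (b %% N k)%N; rewrite add1n rN cN /c c0.
pose g k (t : R) := P k (Num.truncn (t * (L k)%:R)).
(* The error is below [d k + d k.+1], which is three times [d k.+1]; the slightly weaker bound
   [4 * (d k - d k.+1)] telescopes. *)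
have g_step k t : mdist (g k t) (g k.+1 t) <= 4 * (d k - d k.+1).
  rewrite /g/= natrM mulrA; set m := Num.truncn (t * _ * _).
  have -> : Num.truncn (t * (L k)%:R) = (m %/ N k)%N by rewrite truncn_mulnK.
  have [_ /(_ _ _ (lP k (m %/ N k)%N))[_ _ _ /(_ (m %% N k)%N)]] := HNc k.
  by rewrite -/(c k) => /ltW/le_trans; apply; have := dS k; have := d0 k.+1; lra.
have g_dist t k i : mdist (g k t) (g (k + i)%N t) <= 4 * (d k - d (k + i)%N).
  elim: i => [|i IH]; first by rewrite addn0 mdistxx; lra.
  have := metric_triangle (g k t) (g (k + i)%N t) (g (k + i.+1)%N t).
  by have := g_step (k + i)%N t; rewrite addnS; move: IH; lra.
have /choice[h Hh] : forall t, exists p, forall k,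
    mdist (g k t) p <= 4 * e / 2 ^+ k.
  move=> t; apply: (@cauchy_halves_lim (g^~ t)) => k i.
  by have := g_dist t k i; have := d0 (k + i)%N; rewrite -mulrA -/(d k); lra.
have {}Hh t k : mdist (g k t) (h t) <= 4 * d k by rewrite /d mulrA.
have h_eq t p : (forall k, g k t = p) -> h t = p.
  move=> gp; apply/esym/mdist_positivity/eqP; rewrite eq_le mdist_ge0 andbT.
  apply/ler_addgt0Pl => eta eta0; have [k] := halves_lt (4 * e) eta0.
  by rewrite -mulrA -/(d k); have := Hh t k; rewrite gp; lra.
exists h; split.
(* [9 = 4 + 1 + 4]: from [h t] to [g k t], across at most one link, and from [g k s] to [h s]. *)
- apply/continuous_lineP => t eta eta0; have [k] := halves_lt (9 * e) eta0.
  rewrite -mulrA -/(d k) => dk.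
  have Lk : (0 : R) < (L k)%:R by rewrite ltr0n.
  exists (L k)%:R^-1; first by rewrite invr_gt0.
  move=> s ts.
  have gg : mdist (g k t) (g k s) <= d k.
    have : `|t * (L k)%:R - s * (L k)%:R| < 1.
      by rewrite -mulrBl normrM (gtr0_norm Lk) -ltr_pdivlMr// div1r.
    rewrite /g => /truncn_near[->|->|->]; first by rewrite mdistxx ltW.
      have [V [_ V1 V2 dV]] := lP k (Num.truncn (s * (L k)%:R)).
      by rewrite ltW// dV.
    have [V [_ V1 V2 dV]] := lP k (Num.truncn (t * (L k)%:R)).
    by rewrite ltW// dV.
  have := metric_triangle (h t) (g k t) (h s).
  have := metric_triangle (g k t) (g k s) (h s).
  have := Hh t k; have := Hh s k; rewrite (metric_sym (h t) (g k t)); lra.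
- apply: h_eq => k; rewrite /g mul0r truncn0.
  elim: k => //= k IH; rewrite div0n mod0n IH.
  by have [_ /(_ _ _ (lP k 0%N))[]] := HNc k; rewrite IH.
- apply: h_eq => k; rewrite /g mul1r natrK.
  elim: k => //= k IH; rewrite mulnK// modnMl IH.
  by have [_ /(_ _ _ (lP k (L k)))[]] := HNc k; rewrite IH.
- move=> t; have := Hh t 0%N; rewrite /d expr0 divr1 => Ht.
  have g0 : mdist x (g 0%N t) < e.
    by rewrite /g/=; case: (Num.truncn _) => [|?]; [rewrite mdistxx|
      have [V [_ Vx Vy dV]] := lxy; exact: dV].
  have := metric_triangle x (g 0%N t) (h t); lra.
Qed.

End path_connectedness.

Section open_connected.
Context {R : realType} {X : metricType R}.
Hypothesis cX : compact [set: X].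
Hypothesis lcX : locally_connected [set: X].

(** The points reachable by paths in [U] form a set that is both open and closed in [U]. *)
Lemma open_path_connected (U : set X) x y :
  open U -> connected U -> U x -> U y -> exists g : R -> X,
  [/\ continuous g, g 0 = x, g 1 = y & forall t, U (g t)].
Proof.
move=> oU cU Ux Uy.
pose B : set X := [set y | exists g : R -> X,
  [/\ continuous g, g 0 = x, g 1 = y & forall t, U (g t)]].
have BU : B `<=` U by move=> z [g [_ _ <- ]].
have loc z : U z -> exists2 e : R, 0 < e & forall z', mdist z z' < e ->
    (B z <-> B z').
  move=> Uz; have [e e0 He] := (iffLR (open_mdist U)) oU z Uz.
  (* The path of [linked_path] stays within [6 * (e / 10)] of its start, which is within [e / 10] of
     [z]; so it does not leave the ball of radius [e]. *)
  have e10 : 0 < e / 10 by lra.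
  have [W [oW Wz cW dW]] := small_connected lcX z e10.
  have [d d0 Hd] := (iffLR (open_mdist W)) oW z Wz.
  exists d => // z' /Hd Wz'.
  have path_to a b : W a -> W b -> B a -> B b.
    move=> Wa Wb [g [cg g0 g1 gU]].
    have lab : linked (e / 10) a b by exists W.
    have [h [ch h0 h1 hd]] := linked_path cX lcX e10 lab.
    have hU t : U (h t).
      apply: He; have := metric_triangle z a (h t).
      by have := hd t; have := dW _ _ Wz Wa; lra.
    have [|k [ck k0 k1 kU]] := path_cat cg ch _ gU hU; first by rewrite g1 h0.
    by exists k; rewrite k0 k1; split.
  by split; exact: path_to.
suff UB : B = U by have : B y by rewrite UB.
apply: cU.
- exists x; exists (fun=> x); split=> //; exact: cst_continuous.
- exists B; last by rewrite setIidr.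
  apply/open_mdist => z Bz; have [e e0 He] := loc z (BU _ Bz).
  by exists e => // z' /He/iffLR; exact.
- exists (~` (U `&` ~` B)).
    apply: open_closedC; apply/open_mdist => z [Uz nBz].
    have [d d0 Hd] := (iffLR (open_mdist U)) oU z Uz.
    have [e e0 He] := loc z Uz.
    exists (Num.min d e); first by rewrite lt_min d0.
    move=> z'; rewrite lt_min => /andP[/Hd Uz' /He zz']; split=> // Bz'.
    exact/nBz/zz'.
  apply/seteqP; split=> z; first by move=> Bz; split; [exact: BU|case].
  by move=> [Uz nz]; apply: contrapT => nB; apply: nz.
Qed.

End open_connected.

(** * From paths to arcs *)

Section weighted_sum.
Context {R : realType}.
Implicit Types (h : nat -> R) (D e : R).

(** The weights add up to 1, so a uniform error in [h] carries over unchanged to the sum. *)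
Definition wsum h : R := limn (series (fun k => h k / (2 ^ (k + 1))%:R)).

Let pow_gt0 k : (0 : R) < (2 ^ (k + 1))%:R.
Proof. by rewrite ltr0n expn_gt0. Qed.

Lemma is_cvg_wsum h D : (forall k, 0 <= h k <= D) ->
  cvgn (series (fun k => h k / (2 ^ (k + 1))%:R)).
Proof.
move=> hD; apply: (@series_le_cvg _ _ (fun k => D / (2 ^ (k + 1))%:R)) => [k|k|k|].
- by have /andP[h0 _] := hD k; rewrite divr_ge0// ltW.
- by have /andP[h0 hd] := hD k; rewrite divr_ge0// ?(le_trans h0)// ltW.
- by have /andP[h0 hd] := hD k; rewrite ler_pM2r// invr_gt0.
- apply/cvg_ex; exists (D / 2 ^+ 0); exact: cvg_geometric_series_half.
Qed.

Lemma wsum_le h h' D e : (forall k, 0 <= h k <= D) ->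
  (forall k, 0 <= h' k <= D) -> (forall k, h k <= h' k + e) ->
  wsum h <= wsum h' + e.
Proof.
move=> hD hD' hh'.
have ce := @cvg_geometric_series_half R e 0.
have -> : e = limn (series (fun k => e / (2 ^ (k + 1))%:R)).
  by apply/esym; rewrite (cvg_lim _ ce)// expr0 divr1.
have ice : cvgn (series (fun k => e / (2 ^ (k + 1))%:R)).
  by apply/cvg_ex; exists (e / 2 ^+ 0).
rewrite -lim_seriesD//; last exact: is_cvg_wsum hD'.
apply: lim_series_le; [exact: is_cvg_wsum hD| |].
  by apply: is_cvg_seriesD => //; exact: is_cvg_wsum hD'.
by move=> k; rewrite [leRHS]/GRing.add/= -mulrDl ler_pM2r// invr_gt0.
Qed.

Lemma wsum_lt h h' D k0 : (forall k, 0 <= h k <= D) ->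
  (forall k, 0 <= h' k <= D) -> (forall k, h k <= h' k) ->
  h k0 < h' k0 -> wsum h < wsum h'.
Proof.
move=> hD hD' hh' hk; rewrite -subr_gt0 -lim_seriesB; last 2 first.
- exact: is_cvg_wsum hD'.
- exact: is_cvg_wsum hD.
set v := (X in series X).
have v0 k : 0 <= v k.
  by rewrite /v [X in _ <= X]/= -[X in _ <= X]mulrBl divr_ge0 ?subr_ge0// ltW.
have vk : 0 < v k0.
  by rewrite /v [X in _ < X]/= -[X in _ < X]mulrBl divr_gt0 ?subr_gt0.
have cv : cvgn (series v).
  by apply: is_cvg_seriesB; [exact: is_cvg_wsum hD'|exact: is_cvg_wsum hD].
have nd : {homo series v : n m / (n <= m)%N >-> n <= m}.
  by apply/nondecreasing_series => k _ _; exact: v0.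
apply: lt_le_trans (nondecreasing_cvgn_le nd cv k0.+1).
rewrite /series/= big_nat_recr//= ltr_wpDl//.
by apply: sumr_ge0 => k _; exact: v0.
Qed.

End weighted_sum.

Lemma compact_unif (R : realType) (T : pseudoMetricType R) (X : metricType R)
    (A : set T) (f : T -> X) (e : R) :
  compact A -> continuous f -> 0 < e ->
  exists2 d : R, 0 < d &
    forall s t, A s -> A t -> ball s d t -> mdist (f s) (f t) < e.
Proof.
move=> cA cf e0; apply: contrapT => H.
pose B (d : R) : set T := [set s | exists t, [/\ A s, A t, ball s d t &
  e <= mdist (f s) (f t)]].
have [|||p Ap Hp] := @compact_filter_from _ R [set d | 0 < d] B A cA.
- by exists 1 => /=.
- move=> i j /= i0 j0; exists (Num.min i j); first by rewrite /= lt_min i0.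
  move=> s [t [As At bst est]]; split; exists t; split=> //;
    by apply: le_ball bst; rewrite ge_min lexx ?orbT.
- move=> d d0; apply: contrapT => /nonemptyPn AB; apply: H; exists d => //.
  move=> s t As At bst; rewrite ltNge; apply/negP => est.
  have : (A `&` B d) s by split=> //; exists t.
  by rewrite AB.
have e20 : 0 < e / 2 by lra.
have := cf p _ (open_nbhs_nbhs (conj (open_mdist_ball (f p) (e / 2)) _)).
rewrite /= mdistxx => /(_ e20)/nbhs_ballP[d /= d0 Hd].
have d20 : 0 < d / 2 by lra.
have [s [[t [As At st est]] ps]] := Hp _ d20 _ (nbhsx_ballx p (d / 2) d20).
have pt : ball p d t by rewrite (splitr d); exact: ball_triangle ps st.
have {}ps : ball p d s by apply: le_ball ps; lra.
have := Hd _ ps; have := Hd _ pt => /=.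
have := metric_triangle (f s) (f p) (f t); rewrite (metric_sym (f s) (f p)); lra.
Qed.

Lemma compact_mdist_bounded (R : realType) (X : metricType R) (A : set X) :
  compact A -> exists2 D : R, 0 <= D & forall x y, A x -> A y -> mdist x y <= D.
Proof.
move=> cA; have [[a Aa]|A0] := pselect (A !=set0); last first.
  by exists 0 => // x y Ax; case: A0; exists x.
suff [n Hn] : exists n : nat, forall x, A x -> mdist a x <= n%:R.
  exists (2 * n%:R); first by rewrite mulr_ge0.
  move=> x y /Hn ax /Hn ay.
  by have := metric_triangle x a y; rewrite (metric_sym x a); lra.
apply: contrapT => H.
pose B (n : nat) : set X := [set x | n%:R <= mdist a x].
have [|||p Ap Hp] := @compact_filter_from _ nat setT B A cA.
- by exists 0%N.
- move=> i j _ _; exists (maxn i j) => // x /= ijx.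
  by split; apply: le_trans ijx; rewrite ler_nat leq_max leqnn ?orbT.
- move=> n _; apply: contrapT => /nonemptyPn AB; apply: H; exists n => x Ax.
  rewrite leNgt; apply/negP => nx.
  have : (A `&` B n) x by split=> //; exact: ltW.
  by rewrite AB.
have [n pn] : exists n : nat, mdist a p + 1 < n%:R.
  by exists (Num.truncn (mdist a p + 1)).+1; exact: truncnS_gt.

have [|x [/= nx px]] := Hp n I [set y | mdist p y < 1].
  by apply: open_nbhs_nbhs; split; [exact: open_mdist_ball|rewrite /= mdistxx].
have := metric_triangle a p x. move: nx; rewrite /B/=; lra.
Qed.

Section real_compact.
Context {R : realType}.

Lemma compact_max (A : set R) : compact A -> A !=set0 ->
  exists2 m, A m & forall t, A t -> t <= m.
Proof.
move=> cA A0; have [|m] := @compact_EVT_max _ _ idfun A A0 cA.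
  by apply: continuous_subspaceT => x; exact: cvg_id.
by rewrite inE => Am Hm; exists m => // t At; apply: Hm; rewrite inE.
Qed.

Lemma compact_min (A : set R) : compact A -> A !=set0 ->
  exists2 m, A m & forall t, A t -> m <= t.
Proof.
move=> cA A0; have [|m] := @compact_EVT_max _ _ -%R A A0 cA.
  by apply: continuous_subspaceT => x; exact: opp_continuous.
by rewrite inE => Am Hm; exists m => // t At; rewrite -lerN2; apply: Hm;
  rewrite inE.
Qed.

Lemma closed_itv_compact (K : set R) a b : closed K ->
  compact (K `&` [set t | a <= t <= b]).
Proof.
move=> cK; rewrite (_ : [set t | _] = `[a, b]%classic); last first.
  by apply/seteqP; split=> t; rewrite /= in_itv.
by rewrite setIC; apply: compact_closedI => //; exact: segment_compact.
Qed.

(** The ends are the last point of [K] before [c] and the first one after it. *)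
Lemma closed_gap (K : set R) u v c : closed K -> K u -> K v -> u <= c <= v ->
  ~ K c -> exists a b, [/\ K a, K b, u <= a < c, c < b <= v &
    forall t, a < t < b -> ~ K t].
Proof.
move=> cK Ku Kv /andP[uc cv] Kc.
have ne t : K t -> t != c by move=> Kt; apply/eqP => tc; apply: Kc; rewrite -tc.
have [|a [Ka /andP[ua ac]] Ha] := compact_max (@closed_itv_compact K u c cK).
  by exists u; split=> //=; rewrite lexx.
have [|b [Kb /andP[cb bv]] Hb] := compact_min (@closed_itv_compact K c v cK).
  by exists v; split=> //=; rewrite lexx andbT.
exists a, b; split=> //.
- by rewrite ua lt_neqAle ac ne.
- by rewrite bv lt_neqAle cb eq_sym ne.
move=> t /andP[at_ tb] Kt; have [tc|ct] := leP t c.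
  have /Ha : (K `&` [set t | u <= t <= c]) t.
    by split=> //=; rewrite tc (le_trans ua (ltW at_)).
  by lra.
have /Hb : (K `&` [set t | c <= t <= v]) t.
  by split=> //=; rewrite (ltW ct) (le_trans (ltW tb) bv).
by lra.
Qed.

End real_compact.

Section arc_of_path.
Context {R : realType} {X : metricType R}.
Variable g : R -> X.
Hypothesis cg : continuous g.

Let g_unif (e : R) : 0 < e -> exists2 d : R, 0 < d &
  forall s t, 0 <= s <= 1 -> 0 <= t <= 1 -> `|s - t| < d ->
    mdist (g s) (g t) < e.
Proof.
move=> e0; have [d d0 Hd] := compact_unif (@segment_compact _ 0 1) cg e0.
by exists d => // s t s01 t01 st; apply: Hd; rewrite /= ?in_itv.
Qed.

(* What remains of the parameter interval once disjoint loops of [g] have been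
   cut out of it *)
Definition loop_reduction (K : set R) :=
  [/\ closed K, K `<=` [set t | 0 <= t <= 1], K 0, K 1 &
      forall a b, a < b -> K a -> K b -> (forall t, a < t < b -> ~ K t) ->
        g a = g b].

Lemma loop_reduction_itv : loop_reduction [set t | 0 <= t <= 1].
Proof.
split; rewrite /= ?lexx ?ler01//.
  rewrite (_ : [set t | _] = `[0, 1]%classic); first exact: itv_closed.
  by apply/seteqP; split=> t; rewrite /= in_itv.
move=> a b ab /andP[a0 a1] /andP[b0 b1] H; exfalso.
by apply: (H ((a + b) / 2)) => /=; apply/andP; split; lra.
Qed.

(** This bounds chains for Zorn's lemma. A gap of the intersection need not be a gap of any member;
    but by compactness some member misses all of it except for margins [eta] at both ends, and the
    gap of that member around the midpoint has ends close to [a] and [b], with equal images under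
    [g]. *)
Lemma loop_reduction_chain (F : set (set R)) : F !=set0 ->
  total_on F subset -> F `<=` loop_reduction ->
  loop_reduction (\bigcap_(K in F) K).
Proof.
move=> [K0 FK0] tF FL; split.
- by apply: closed_bigI => K /FL[].
- by move=> t /(_ _ FK0); have [_ + _ _ _] := FL _ FK0; apply.
- by move=> K /FL[].
- by move=> K /FL[].
- move=> a b ab Ka Kb abK; apply/mdist_positivity/eqP.
  rewrite eq_le mdist_ge0 andbT; apply/ler_addgt0Pl => e e0; rewrite addr0.
  have e20 : 0 < e / 2 by lra.
  have [d d0 Hd] := g_unif e20.
  (* [eta < d] keeps the images of the margins within [e / 2]; [eta < (b - a) / 2] keeps the
     midpoint off the margins. *)
  have [eta eta0 [etad etaab]] : exists2 eta : R, 0 < eta &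
      eta < d /\ eta < (b - a) / 2.
    exists (Num.min d ((b - a) / 2) / 2).
      by rewrite divr_gt0// lt_min d0; lra.
    by have [] := leP d ((b - a) / 2); lra.
  have [K FK IK] : exists2 K, F K & forall t, a + eta <= t <= b - eta -> ~ K t.
    apply: contrapT => H.
    have [||K /FL[]//|K FK|p] :=
        @compact_chain _ F [set t | a + eta <= t <= b - eta] _ _ tF.
    + by have := @closed_itv_compact R setT (a + eta) (b - eta) closedT;
        rewrite setTI.
    + by exists K0.
    + apply: contrapT => /nonemptyPn IK; apply: H; exists K => // t It Kt.
      have : ([set t | a + eta <= t <= b - eta] `&` K) t by [].
      by rewrite IK.
    + move=> /= /andP[ap pb] Kp; apply: (abK p) => //.
      by apply/andP; split; lra.
  have [cK K01 _ _ gapK] := FL _ FK.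
  have cab : a <= (a + b) / 2 <= b by apply/andP; split; lra.
  have [|a' [b' [Ka' Kb' /andP[aa' a'c] /andP[cb' b'b] gap]]] :=
      closed_gap cK (Ka _ FK) (Kb _ FK) cab.
    by apply: IK; apply/andP; split; lra.
  have ab' : a' < b' by lra.
  have gab := gapK _ _ ab' Ka' Kb' gap.
  have a'e : a' < a + eta.
    by rewrite ltNge; apply/negP => h; apply: (IK a') => //; apply/andP; lra.
  have b'e : b - eta < b'.
    by rewrite ltNge; apply/negP => h; apply: (IK b') => //; apply/andP; lra.
  have g1 : mdist (g a) (g a') < e / 2.
    apply: Hd; [exact: K01 (Ka _ FK)|exact: K01|].
    by rewrite ler0_norm; lra.
  have g2 : mdist (g b') (g b) < e / 2.
    apply: Hd; [exact: K01|exact: K01 (Kb _ FK)|].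
    by rewrite ler0_norm; lra.
  have := metric_triangle (g a) (g a') (g b); rewrite {2}gab; lra.
Qed.

(** Take [K] minimal for inclusion: if [g s = g t], cutting []s, t[] out of [K] leaves a loop
    reduction. So on [K] the map [g] identifies nothing but the two ends of a gap. *)
Lemma minimal_loop_reduction : exists2 K, loop_reduction K &
  forall s t u, K s -> K t -> g s = g t -> s < u < t -> ~ K u.
Proof.
pose T := {K : set R | loop_reduction K}.
pose r (K L : T) := `[< sval L `<=` sval K >].
have [|||K Kmax] := @ZL_preorder T (exist _ _ loop_reduction_itv) r.
- by move=> K; apply/asboolP.
- move=> K L M /asboolP KL /asboolP LM.
  by apply/asboolP => t /LM/KL.
- move=> A tA; have [A0|nA] := pselect (A !=set0); last first.
    by exists (exist _ _ loop_reduction_itv) => K AK; case: nA; exists K.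
  have lP : loop_reduction (\bigcap_(K in sval @` A) K).
    apply: loop_reduction_chain.
    + by have [K AK] := A0; exists (sval K), K.
    + move=> _ _ [K AK <-] [L AL <-].
      by have [/asboolP|/asboolP] := tA _ _ AK AL; [right|left].
    + by move=> _ [K AK <-]; exact: svalP.
  exists (exist _ _ lP) => K AK; apply/asboolP => t /=; apply.
  by exists K.
case: K Kmax => K lK Kmax; exists K => //.
have [cK K01 K0 K1 gapK] := lK.
move=> s t u Ks Kt gst /andP[su ut] Ku.
pose K' := K `&` ~` [set v | s < v < t].
have lK' : loop_reduction K'.
  split.
  - apply: closedI => //; apply: open_closedC.
    rewrite (_ : [set v | _] = `]s, t[%classic); first exact: interval_open.
    by apply/seteqP; split=> v; rewrite /= in_itv.
  - by move=> v [/K01].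
  - by split=> //= /andP[s0 _]; have /andP[] := K01 _ Ks; lra.
  - by split=> //= /andP[_ t1]; have /andP[] := K01 _ Kt; lra.
  - move=> a b ab [Ka /= na] [Kb /= nb] H.
    (* A gap of [K'] that is no gap of [K] contains a removed point, and then it is []s, t[]
       itself. *)
    have [nK|] := pselect (forall v, a < v < b -> ~ K v); first exact: gapK.
    move=> /existsNP[v /not_implyP[/andP[av vb] /contrapT Kv]].
    have /andP[sv vt] : s < v < t.
      by apply: contrapT => nv; apply: (H v); [rewrite av|split].
    have sa : s <= a.
      rewrite leNgt; apply/negP => as_; apply: (H s); first by apply/andP; lra.
      by split=> //= /andP[]; lra.
    have bt : b <= t.
      rewrite leNgt; apply/negP => bt_; apply: (H t); first by apply/andP; lra.
      by split=> //= /andP[]; lra.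
    have -> : a = s.
      apply/eqP; rewrite eq_le sa andbT leNgt; apply/negP => sa'; apply: na.
      by apply/andP; lra.
    have -> // : b = t.
    apply/eqP; rewrite eq_le bt /= leNgt; apply/negP => bt'; apply: nb.
    by apply/andP; lra.
have /asboolP KK' : r (exist _ _ lK') (exist _ _ lK).
  by apply: Kmax; apply/asboolP => v [].
by have [_] := KK' _ Ku; apply; rewrite /= su.
Qed.

End arc_of_path.

Section dist_to_initial.
Context {R : realType} {X : metricType R}.
Variables (g : R -> X) (K : set R).
Hypothesis K0 : K 0.

(* As [t] grows this decreases, strictly so for some [z] as soon as new points
   of the arc are swept; a weighted sum over a dense sequence of [z] therefore
   parametrizes the arc injectively *)
Definition dist_initial (z : X) (t : R) : R :=
  inf [set mdist z (g s) | s in K `&` [set s | s <= t]].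

Lemma dist_initial_le z s t : K s -> s <= t ->
  dist_initial z t <= mdist z (g s).
Proof.
move=> Ks st; apply: ge_inf; last by exists s.
by exists 0 => _ [u _ <-]; exact: mdist_ge0.
Qed.

Lemma le_dist_initial z t c : 0 <= t ->
  (forall s, K s -> s <= t -> c <= mdist z (g s)) -> c <= dist_initial z t.
Proof.
move=> t0 H; apply: lb_le_inf; first by exists (mdist z (g 0)), 0.
by move=> _ [u [Ku ut] <-]; exact: H.
Qed.

Lemma dist_initial_homo z s t : 0 <= s -> s <= t ->
  dist_initial z t <= dist_initial z s.
Proof.
move=> s0 st; apply: le_dist_initial => // v Kv vs.
by apply: dist_initial_le => //; exact: le_trans st.
Qed.

End dist_to_initial.

Section path_to_arc.
Context {R : realType} {X : metricType R}.
Variable g : R -> X.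
Hypothesis cg : continuous g.

Lemma dense_sequence : exists z : nat -> X,
  forall t (e : R), 0 < e -> exists k, mdist (z k) (g t) < e.
Proof.
exists (fun k => g (if choice.unpickle k is Some q then ratr (q : rat) else 0)).
move=> t e e0.
have [d d0 Hd] := (iffLR (continuous_lineP g)) cg t e e0.
have [q] := @rat_in_itvoo R (t - d) (t + d) ltac:(lra).
rewrite in_itv/= => /andP[q1 q2]; exists (choice.pickle q); rewrite choice.pickleK metric_sym.
by apply: Hd; rewrite ltr_norml; apply/andP; split; lra.
Qed.

(** The arc is the image of a minimal loop reduction [K]. The function [phi] is continuous and
    nondecreasing, and on [K] it takes equal values exactly where [g] does. Hence [g] composed with
    any choice [kap] of preimages under [phi], rescaled to the unit interval, is injective and
    continuous. *)
Lemma path_arc : g 0 <> g 1 -> exists a : R -> X,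
  [/\ {within `[0, 1], continuous a}, a 0 = g 0, a 1 = g 1,
      (forall s t : R, 0 <= s <= 1 -> 0 <= t <= 1 -> a s = a t -> s = t) &
      forall t, exists u, a t = g u].
Proof.
move=> g01.
have [K [cK K01 K0 K1 gapK] minK] := minimal_loop_reduction cg.
have [z z_dense] := dense_sequence.
have [D D0 HD] : exists2 D : R, 0 <= D &
    forall s t, 0 <= s <= 1 -> 0 <= t <= 1 -> mdist (g s) (g t) <= D.
  have cgI : compact (g @` `[0, 1]%classic).
    by apply: continuous_compact; [exact: continuous_subspaceT|exact: segment_compact].
  have [D D0 HD] := compact_mdist_bounded cgI.
  exists D => // s t s01 t01.
  by apply: HD; [exists s|exists t] => //=; rewrite in_itv.
pose m := dist_initial g K.
pose h t k : R := m (z k) 0 - m (z k) t.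
have hD t : 0 <= t <= 1 -> forall k, 0 <= h t k <= D.
  move=> /andP[t0 t1] k; rewrite subr_ge0 dist_initial_homo//= lerBlDr.
  rewrite -lerBlDl; apply: le_dist_initial => // s Ks st.
  have m0 : m (z k) 0 <= mdist (z k) (g 0) by exact: dist_initial_le.
  have := metric_triangle (z k) (g s) (g 0).
  have := HD s 0 (K01 _ Ks); rewrite lexx ler01 => /(_ isT); lra.
pose phi t : R := wsum (h t).
have phi0 : phi 0 = 0.
  rewrite /phi /wsum (_ : (fun k => _) = fun=> 0).
    rewrite (_ : series _ = fun=> 0) ?lim_cst//.
    by apply/funext => n; rewrite /series/= big1.
  by apply/funext => k; rewrite /h subrr mul0r.
(* An equicontinuity estimate, uniform in the reference point [y], so that it survives the weighted
   sum. *)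
have osc (e : R) : 0 < e -> exists2 d : R, 0 < d & forall s t, 0 <= s ->
    s <= t -> t <= 1 -> t - s < d -> forall y, m y s <= m y t + e.
  move=> e0.
  have [d d0 Hd] := compact_unif (@segment_compact R 0 1) cg e0.
  exists d => // s t s0 st t1 tsd y; rewrite -lerBlDr; apply: le_dist_initial.
  - exact: K0.
  - exact: le_trans st.
  move=> v Kv vt; have [vs|sv] := leP v s.
    have := dist_initial_le g y Kv vs; rewrite -/(m y s); lra.
  have [v0 v1] : 0 <= v /\ v <= 1 by have /andP[] := K01 _ Kv.
  (* A point [v] of [K] after [s] is replaced by a point of [K] up to [s]. If [s] lies in a gap, its
     left end [a] will do: [g a = g b], and the right end [b] lies between [s] and [v]. *)
  have [u [Ku us gu]] : exists u, [/\ K u, u <= s & mdist (g u) (g v) < e].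
    have near b : s <= b -> b <= v -> mdist (g b) (g v) < e.
      move=> sb bv; apply: Hd; rewrite /= ?in_itv/=; [apply/andP; lra|apply/andP; lra|].
      by rewrite /ball/= ler0_norm; lra.
    have [Ks|nKs] := pselect (K s); first by exists s; split=> //; apply: near; lra.
    have s0v : 0 <= s <= v by apply/andP; lra.
    have [a [b [Ka Kb /andP[a0 as_] /andP[sb bv] gap]]] :=
      closed_gap cK K0 Kv s0v nKs.
    exists a; split=> //; first exact: ltW.
    by rewrite (gapK a b)//; [apply: near => //; exact: ltW|exact: lt_trans sb].
  have := dist_initial_le g y Ku us; rewrite -/(m y s).
  have := metric_triangle y (g v) (g u); rewrite (metric_sym (g v)); lra.
have phi_le s t : 0 <= s -> s <= t -> t <= 1 -> phi s <= phi t.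
  move=> s0 st t1; rewrite -[leRHS]addr0.
  apply: (@wsum_le _ _ _ D) => [||k].
  - by apply: hD; rewrite s0 (le_trans st).
  - by apply: hD; rewrite t1 (le_trans s0).
  - by rewrite addr0 lerB//; exact: dist_initial_homo.
have phi_osc (e : R) : 0 < e -> exists2 d : R, 0 < d & forall s t, 0 <= s ->
    s <= t -> t <= 1 -> t - s < d -> phi t <= phi s + e.
  move=> e0; have [d d0 Hd] := osc _ e0; exists d => // s t s0 st t1 std.
  apply: (@wsum_le _ _ _ D) => [||k].
  - by apply: hD; rewrite t1 (le_trans s0).
  - by apply: hD; rewrite s0 (le_trans st).
  - by have := Hd _ _ s0 st t1 std (z k); rewrite /h; lra.
(* If every value of [g] on [K] after [s] is already taken by then, no initial distance changes. *)
have phi_const s t : 0 <= s -> s <= t -> (forall v, K v -> s < v <= t ->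
    exists2 u, K u /\ u <= s & g u = g v) -> phi s = phi t.
  move=> s0 st H; congr wsum; apply/funext => k; congr (_ - _).
  apply/eqP; rewrite eq_le; apply/andP; split; last exact: dist_initial_homo.
  apply: le_dist_initial => //; first exact: le_trans st.
  move=> v Kv vt; have [vs|sv] := leP v s; first exact: dist_initial_le.
  have [|u [Ku us] <-] := H v Kv; first by rewrite sv.
  exact: dist_initial_le.
have phi_lt s t : K s -> K t -> s < t -> g s <> g t -> phi s < phi t.
  move=> Ks Kt st gst.
  have /andP[s0 s1] := K01 _ Ks; have /andP[t0 t1] := K01 _ Kt.
  have cF : compact (g @` (K `&` [set u | 0 <= u <= s])).
    by apply: continuous_compact;
      [exact: continuous_subspaceT|exact: closed_itv_compact].
  have [|eta eta0 Heta] := closed_mdist (compact_closed (@metric_hausdorff _ X) cF)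
      (p := g t).
    move=> [u [Ku /= /andP[u0 us]] gut]; have [us'|su] := ltP u s.
      by apply: (minK u t s) => //; rewrite us'.
    by apply: gst; rewrite -gut; congr g; apply/le_anti; rewrite us su.
  have e3 : 0 < eta / 3 by lra.
  (* The distance from [z k] to the initial part is below [eta / 3] at time [t] but at least
     [2 * eta / 3] at time [s]. *)
  have [k zk] := z_dense t _ e3.
  apply: (@wsum_lt _ _ _ D k); [by apply: hD; rewrite s0|by apply: hD; rewrite t0| |].
    by move=> j; rewrite lerB//; apply: dist_initial_homo => //; exact: ltW.
  rewrite ltrD2l ltrN2.
  have mt : m (z k) t <= mdist (z k) (g t) by exact: dist_initial_le.
  suff : eta - eta / 3 <= m (z k) s by move: zk mt; lra.
  apply: le_dist_initial => // v Kv vs.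
  have : eta <= mdist (g t) (g v).
    rewrite leNgt; apply/negP => /Heta; apply; exists v => //; split=> //=.
    by rewrite vs andbT; have /andP[] := K01 _ Kv.
  have := metric_triangle (g t) (z k) (g v); rewrite (metric_sym (g t) (z k)); lra.
have phi_eq s t : K s -> K t -> phi s = phi t <-> g s = g t.
  have H u v : K u -> K v -> u < v -> phi u = phi v <-> g u = g v.
    move=> Ku Kv uv; split=> [puv|guv].
      by apply: contrapT => guv; have := phi_lt _ _ Ku Kv uv guv; rewrite puv ltxx.
    apply: phi_const; [by have /andP[] := K01 _ Ku|exact: ltW|].
    move=> w Kw /andP[uw]; rewrite le_eqVlt => /orP[/eqP ->|wv].
      by exists u.
    by exfalso; apply: (minK u v w) => //; rewrite uw.
  move=> Ks Kt; have [st|ts|->] := ltgtP s t; [exact: H| |by []].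
  by have [H1 H2] := H _ _ Kt Ks ts; split=> /esym; [move/H1|move/H2].
have phi_cont : {within `[0, 1], continuous phi}.
  apply/subspace_continuousP => t; rewrite /= in_itv/= => /andP[t0 t1].
  apply/cvgrPdist_lt => e e0.
  have e20 : 0 < e / 2 by lra.
  have [d d0 Hd] := phi_osc _ e20.
  apply/nbhs_ballP; exists d => // s; rewrite /ball/= => /ltr_normB[ts st].
  rewrite in_itv/= => /andP[s0 s1]; rewrite ltr_norml; apply/andP; rewrite /from_subspace.
  have [st'|ts'] := leP s t.
    have := phi_le _ _ s0 st' t1; have := Hd _ _ s0 st' t1 ltac:(lra); lra.
  have := phi_le _ _ t0 (ltW ts') s1; have := Hd _ _ t0 (ltW ts') s1 ltac:(lra); lra.
have phi1 : 0 < phi 1 by rewrite -phi0; exact: phi_lt.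
(* The intermediate value theorem may return a point inside a gap; the left end of that gap has the
   same [phi]. *)
have phi_onto y : 0 <= y <= 1 -> exists2 t, K t & phi t = y * phi 1.
  move=> /andP[y0 y1].
  have [|c] := @IVT R phi 0 1 (y * phi 1) ler01 phi_cont.
    rewrite phi0 min_l ?(ltW phi1)// max_r ?(ltW phi1)//.
    by apply/andP; split; nra.
  rewrite in_itv/= => c01 pc; have [Kc|nKc] := pselect (K c); first by exists c.
  have [a [b [Ka Kb /andP[a0 ac] /andP[cb b1] gap]]] := closed_gap cK K0 K1 c01 nKc.
  exists a => //; rewrite -pc; apply: phi_const; [exact: a0|exact: ltW|].
  move=> v Kv /andP[av vc]; exfalso; apply: (gap v) => //.
  by rewrite av (le_lt_trans vc).
have /choice[kap Hkap] : forall y, exists t, K t /\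
    (0 <= y <= 1 -> phi t = y * phi 1).
  move=> y; have [/phi_onto[t Kt pt]|ny] := pselect (0 <= y <= 1).
    by exists t.
  by exists 0.
have Kkap y : K (kap y) by have [] := Hkap y.
have pkap y : 0 <= y <= 1 -> phi (kap y) = y * phi 1 by have [] := Hkap y.
exists (g \o kap); split.
- apply/subspace_continuousP => y; rewrite /= in_itv/= => y01.
  apply/metricType_numDomainType.cvgrPdist_lt => e e0.
  (* The points of [K] with image far from [g (kap y)]. Their [phi]-values form a compact set
     missing [y * phi 1], hence missing a neighbourhood of it. *)
  pose C := K `&` [set t | 0 <= t <= 1] `&` [set t | e <= mdist (g (kap y)) (g t)].
  have cC : compact C.
    apply: compact_closedI; first exact: closed_itv_compact.
    rewrite (_ : [set t | _] = ~` (g @^-1` [set x | mdist (g (kap y)) x < e])).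
      apply: open_closedC; apply: open_comp; last exact: open_mdist_ball.
      by move=> t _; exact: cg.
    by apply/seteqP; split=> t /=; [rewrite leNgt => /negP|move/negP; rewrite -leNgt].
  have cpC : compact (phi @` C).
    apply: continuous_compact => //; apply: continuous_subspaceW phi_cont.
    by move=> t [[_ /=]]; rewrite in_itv.
  have npC : ~ (phi @` C) (y * phi 1).
    move=> [t [[Kt _] /= et]]; rewrite -pkap// => /phi_eq-/(_ Kt (Kkap _)) gt.
    by move: et; rewrite gt mdistxx; lra.
  have /nbhs_ballP[d /= d0 Hd] : nbhs (y * phi 1) (~` (phi @` C)).
    by apply: open_nbhs_nbhs; split=> //; apply: closed_openC;
      exact: compact_closed (@Rhausdorff R) cpC.
  apply/nbhs_ballP; exists (d / phi 1) => /=; first by rewrite divr_gt0.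
  move=> y'; rewrite /ball/= => yy' ; rewrite in_itv/= => y'01.
  rewrite ltNge; apply/negP => ey'.
  apply: (Hd (y' * phi 1)).
    by rewrite /ball/= -mulrBl normrM (gtr0_norm phi1) -ltr_pdivlMr.
  by exists (kap y'); [split=> //; split=> //; exact: K01|exact: pkap].
- by apply/phi_eq => //; rewrite pkap ?lexx ?ler01// mul0r phi0.
- by apply/phi_eq => //; rewrite pkap ?lexx ?ler01// mul1r.
- move=> s t s01 t01 /= /phi_eq-/(_ (Kkap _) (Kkap _)).
  by rewrite !pkap// => /mulIf; apply; rewrite gt_eqF.
- by move=> t; exists (kap t).
Qed.

End path_to_arc.

(** * Arcs and simple closed curves *)

Section arcs.
Context {R : realType} {X : metricType R}.

Definition arc (a : R -> X) (x y : X) :=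
  [/\ continuous a, a 0 = x, a 1 = y &
      forall s t : R, 0 <= s <= 1 -> 0 <= t <= 1 -> a s = a t -> s = t].

Lemma open_connected_arc (U : set X) x y :
  compact [set: X] -> locally_connected [set: X] ->
  open U -> connected U -> U x -> U y -> x <> y ->
  exists2 a, arc a x y & forall t, U (a t).
Proof.
move=> cX lcX oU cU Ux Uy xy.
have [g [cg g0 g1 gU]] := open_path_connected cX lcX oU cU Ux Uy.
have [|a [ca a0 a1 ainj ag]] := path_arc cg; first by rewrite g0 g1.
(* [path_arc] gives continuity within the unit interval only; precomposing with the retraction [c]
   of the line, which is 1-Lipschitz, extends it to the whole line. *)
pose c (t : R) : R := Num.max 0 (Num.min t 1).
have cC t : [/\ t <= 0 & c t = 0] \/ [/\ 0 <= t, t <= 1 & c t = t] \/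
    [/\ 1 <= t & c t = 1].
  rewrite /c; have [t1|t1] := leP t 1; last by right; right; rewrite max_r ?ltW.
  by have [t0|t0] := leP 0 t; [right; left|left; split=> //; exact: ltW].
have cP t : 0 <= c t <= 1.
  by have [[? ->]|[[? ? ->]|[? ->]]] := cC t; apply/andP; lra.
have cE t : 0 <= t <= 1 -> c t = t.
  by move=> /andP[? ?]; have [[? ->]|[[? ? ->]|[? ->]]] := cC t; lra.
have c_lip t s : `|c t - c s| <= `|t - s|.
  rewrite ler_norml; have := ler_norm (t - s); have := ler_norm (s - t).
  rewrite (distrC s t); move: `|t - s| => n.
  by have [[? ->]|[[? ? ->]|[? ->]]] := cC t;
    have [[? ->]|[[? ? ->]|[? ->]]] := cC s; move=> ? ?; apply/andP; lra.
exists (a \o c); last by move=> t /=; have [u ->] := ag (c t).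
split; rewrite /= ?cE ?lexx ?ler01 ?a0 ?a1//.
- apply/continuous_lineP => t e e0.
  have ct : c t \in `[0, 1] by rewrite in_itv /= cP.
  have := (iffLR (subspace_continuousP _ _)) ca (c t) ct.
  move=> /metricType_numDomainType.cvgrPdist_lt/(_ e e0)/nbhs_ballP[d /= d0 Hd].
  exists d => // s ts; apply: Hd; last by rewrite /= in_itv /= cP.
  by rewrite /ball/=; apply: le_lt_trans ts.
- by move=> s t s01 t01 /ainj; rewrite !cE//; apply.
Qed.

(** The inverse is continuous because closed subsets of [K] have compact, hence closed, images. *)
Lemma compact_homeomorphic (T U : topologicalType) (K : set T) (h : T -> U) :
  hausdorff_space U -> compact K -> K !=set0 -> {within K, continuous h} ->
  {in K &, injective h} -> homeomorphic K (h @` K).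
Proof.
move=> hU cK [x0 Kx0] ch hinj.
have /choice[g Hg] : forall y, exists x, (h @` K) y -> K x /\ h x = y.
  move=> y; have [[x Kx <-]|nK] := pselect ((h @` K) y); first by exists x.
  by exists x0.
have gh x : K x -> g (h x) = x.
  move=> Kx; have [Kg hg] := Hg (h x) (imageP h Kx).
  by apply: hinj => //; rewrite inE.
exists h, g; split=> //.
- apply/continuous_closedP => C cC; apply/closed_subspaceP.
  exists (h @` (K `&` C)).
    apply: compact_closed => //; apply: continuous_compact.
      by apply: continuous_subspaceW ch => x [].
    exact: compact_closedI.
  apply/seteqP; split=> y [].
    by move=> [x [Kx Cx] <-] hK; split=> //; rewrite /preimage/from_subspace/= gh.
  move=> /= Cgy hKy; split=> //; have [Kg hg] := Hg _ hKy.
  by exists (g y).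
- by move=> x Kx; split; [exists x|exact: gh].
Qed.

Lemma compact_unit_circle : compact (@unit_circle R).
Proof.
have sq (x y : R) : x ^+ 2 + y ^+ 2 = 1 -> x \in `[-1, 1].
  move=> xy; have := sqr_ge0 y; have x1 : x ^+ 2 <= 1 by nra.
  by rewrite in_itv/= => y0; rewrite -ler_norml -(expr_le1 (n := 2))// real_normK// num_real.
rewrite (_ : @unit_circle R =
    (`[-1, 1]%classic `*` `[-1, 1]%classic) `&` @unit_circle R); last first.
  apply/seteqP; split=> z; last by case.
  move=> zP; split=> //; split=> /=; first exact: sq zP.
  by move: zP; rewrite /unit_circle/= addrC => /sq.
apply: compact_closedI; first by apply: compact_setX; exact: segment_compact.
apply: (@preimage_closed _ _ (fun z : R * R => z.1 ^+ 2 + z.2 ^+ 2) [set x | x = 1]);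
  last exact: closed_eq.
move=> z _; apply: cvgD; rewrite /= expr2; under eq_fun do rewrite expr2.
  by apply: cvgM; exact: cvg_fst.
by apply: cvgM; exact: cvg_snd.
Qed.

(* The upper half circle is mapped along [A], the lower one along [B] *)
Lemma two_arcs_simple_closed_curve (A B : R -> X) :
  continuous A -> continuous B ->
  {in `[-1, 1] &, injective A} -> {in `[-1, 1] &, injective B} ->
  A (-1) = B (-1) -> A 1 = B 1 ->
  (forall s t, s \in `[-1, 1] -> t \in `]-1, 1[ -> A s <> B t) ->
  exists S, @simple_closed_curve R X S.
Proof.
move=> cA cB iA iB AB0 AB1 AB.
pose h (z : R * R) := if 0 <= z.2 then A z.1 else B z.1.
have itv (z : R * R) : @unit_circle R z -> z.1 \in `[-1, 1].
  rewrite /unit_circle/= => zP; have z2 := sqr_ge0 z.2.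
  by rewrite in_itv/= -ler_norml -(expr_le1 (n := 2))// real_normK ?num_real//; lra.
(* On the horizontal axis the circle has only the points [(1, 0)] and [(-1, 0)], where [A] and [B]
   agree. *)
have up (z : R * R) : @unit_circle R z -> z.2 <= 0 -> h z = B z.1.
  rewrite /h /unit_circle/= => zP z0; case: ifPn => // z0'.
  have z20 : z.2 = 0 by apply/le_anti; rewrite z0.
  move: zP; rewrite z20 expr0n/= addr0 => /eqP; rewrite sqrf_eq1.
  by move=> /orP[/eqP ->|/eqP ->].
have inj z w : @unit_circle R z -> @unit_circle R w -> h z = h w -> z.1 = w.1 /\
    ((0 <= z.2) = (0 <= w.2) \/ z.1 ^+ 2 = 1).
  move=> zP wP; have zi := itv _ zP; have wi := itv _ wP.
  rewrite /h; case: ifPn => z0; case: ifPn => w0.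
  - by move=> /iA-> //; split=> //; left.
  - have [w1|w1] := boolP (w.1 \in `]-1, 1[); first by move/AB; case.
    have ww : w.1 ^+ 2 = 1.
      apply/eqP; rewrite sqrf_eq1; move: w1 wi; rewrite !in_itv/= negb_and -!leNgt.
      by move=> /orP[] ? /andP[]? ?; apply/orP; [right|left]; apply/eqP; lra.
    have -> : B w.1 = A w.1.
      by move/eqP: ww; rewrite sqrf_eq1 => /orP[/eqP ->|/eqP ->].
    by move=> /iA ->//; split=> //; right.
  - have [z1|z1] := boolP (z.1 \in `]-1, 1[); first by move/esym/AB; case.
    have zz : z.1 ^+ 2 = 1.
      apply/eqP; rewrite sqrf_eq1; move: z1 zi; rewrite !in_itv/= negb_and -!leNgt.
      by move=> /orP[] ? /andP[]? ?; apply/orP; [right|left]; apply/eqP; lra.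
    have -> : B z.1 = A z.1.
      by move/eqP: zz; rewrite sqrf_eq1 => /orP[/eqP ->|/eqP ->].
    by move=> zw; split; [exact: iA|right].
  - by move=> /iB-> //; split=> //; left.
exists (h @` @unit_circle R); apply: compact_homeomorphic.
- exact: metric_hausdorff.
- exact: compact_unit_circle.
- by exists (1, 0); rewrite /unit_circle/= expr1n expr0n addr0.
- have cle : closed [set z : R * R | z.2 <= 0].
    apply: (@preimage_closed _ _ (fun z : R * R => z.2) [set x | x <= 0]);
      last exact: closed_le.
    by move=> z _; exact: cvg_snd.
  have cge : closed [set z : R * R | 0 <= z.2].
    apply: (@preimage_closed _ _ (fun z : R * R => z.2) [set x | 0 <= x]);
      last exact: closed_ge.
    by move=> z _; exact: cvg_snd.
  have cC : closed (@unit_circle R).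
    by apply: compact_closed compact_unit_circle; exact: norm_hausdorff.
  rewrite (_ : @unit_circle R = (@unit_circle R `&` [set z | 0 <= z.2]) `|`
      (@unit_circle R `&` [set z | z.2 <= 0])); last first.
    apply/seteqP; split=> z; last by case=> -[].
    by move=> zP; have [z0|/ltW z0] := leP 0 z.2; [left|right].
  apply: withinU_continuous; [exact: closedI|exact: closedI| |].
  + apply: (@subspace_eq_continuous _ _ _ (A \o fst)).
      by move=> z; rewrite inE => -[_ /= z0]; rewrite /from_subspace /h z0.
    apply: continuous_subspaceT => z; apply: continuous_comp; last exact: cA.
    exact: cvg_fst.
  + apply: (@subspace_eq_continuous _ _ _ (B \o fst)).
      by move=> z; rewrite inE => -[zP /= z0]; rewrite /from_subspace up.
    apply: continuous_subspaceT => z; apply: continuous_comp; last exact: cB.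
    exact: cvg_fst.
- move=> z w; rewrite !inE => zP wP /(inj _ _ zP wP)[zw1 H].
  have zw2 : z.2 ^+ 2 = w.2 ^+ 2.
    by move: zP wP; rewrite /unit_circle/= zw1 => zP wP; lra.
  suff : z.2 = w.2 by case: z w zw1 {zP wP H zw2} => [a b] [c d] /= -> ->.
  case: H => [H|z1].
    move/eqP: zw2; rewrite eqf_sqr => /orP[/eqP//|/eqP zw].
    move: H; rewrite zw oppr_ge0; case: (leP 0 w.2) => [w0|/ltW ->//] w0'.
    by have -> : w.2 = 0; [apply/le_anti; rewrite w0 w0'|rewrite oppr0].
  have z2 : z.2 ^+ 2 = 0 by move: zP; rewrite /unit_circle/=; lra.
  move/eqP: (z2); rewrite sqrf_eq0 => /eqP ->.
  by move: zw2; rewrite z2 => /esym/eqP; rewrite sqrf_eq0 => /eqP ->.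
Qed.

End arcs.

(** * Segments and halfspaces in a dendrite *)

Lemma line_segment_image (R : realType) (X : topologicalType) (a : R -> X) s t :
  continuous a -> compact (a @` `[s, t]%classic) /\ connected (a @` `[s, t]%classic).
Proof.
move=> ca; split.
  by apply: continuous_compact; [exact: continuous_subspaceT|exact: segment_compact].
apply: connected_continuous_connected; first exact: segment_connected.
exact: continuous_subspaceT.
Qed.

Section dendrite_structure.
Context {R : realType} {X : metricType R}.
Hypothesis dX : dendrite [set: X].
Implicit Types (x y z p q : X) (A C H U : set X).

Lemma dendrite_compact : compact [set: X].
Proof. by have [[]] := dX. Qed.

Lemma dendrite_locally_connected : locally_connected [set: X].
Proof. by have [] := dX. Qed.

Lemma component_open U x : open U -> open (connected_component U x).
Proof.
move=> oU; rewrite openE => y Cy.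
have Uy := connected_component_sub Cy.
have [//||W [oW Wy]] := dendrite_locally_connected (p := y) (U := U) I => //.
rewrite setTI => WU cW; rewrite /interior; apply: filterS (open_nbhs_nbhs (conj oW Wy)).
move=> w Ww; apply: connected_component_trans Cy _.
exact: connected_component_max cW _ Ww.
Qed.

(** Otherwise the component of [x] off [a t], which is open, contains a second arc [b] from [x] to
    [y]. A piece of [b] bypassing [a t] and the piece of [a] with the same ends form a simple closed
    curve. *)
Lemma arc_cut a x y (t : R) : arc a x y -> 0 < t < 1 ->
  ~ connected_component (~` [set a t]) x y.
Proof.
move=> [ca a0 a1 ainj] /andP[t0 t1].
set z := a t; set U := ~` [set z]; set C := connected_component U x => Cy.
have oU : open U.
  apply: closed_openC; apply: accessible_closed_set1.
  exact/hausdorff_accessible/metric_hausdorff.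
have zx : z <> x.
  by rewrite -a0 => /ainj H; have := H ltac:(lra) ltac:(lra); lra.
have Cx : C x by apply: connected_component_refl => /esym.
have xy : x <> y by rewrite -a0 -a1 => /ainj H; have := H ltac:(lra) ltac:(lra); lra.
have [b [cb b0 b1 binj] bC] := open_connected_arc dendrite_compact
  dendrite_locally_connected (component_open x oU) (@component_connected _ U x)
  Cx Cy xy.
have bz u : b u <> z by have := connected_component_sub (bC u).
have cl s u : closed (b @^-1` (a @` `[s, u]%classic)).
  apply: preimage_closed => [v _|]; first exact: cb.
  exact: compact_closed (@metric_hausdorff _ _) (line_segment_image s u ca).1.
(* The last time [b] meets the part of [a] up to [t], then the first later time it meets the part
   from [t] on; strictly between these times [b] avoids [a]. *)
have [|u0 [[s0 s0P as0] /andP[u00 u01]] u0max] :=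
    compact_max (@closed_itv_compact _ _ 0 1 (cl 0 t)).
  exists 0; split; last by rewrite /= lexx ler01.
  by exists 0; rewrite ?a0 ?b0//= in_itv/= lexx ltW.
have [|u1 [[s1 s1P as1] /andP[u10 u11]] u1min] :=
    compact_min (@closed_itv_compact _ _ u0 1 (cl t 1)).
  exists 1; split; last by rewrite /= lexx andbT.
  by exists 1; rewrite ?a1 ?b1//= in_itv/= lexx ltW.
move: s0P s1P; rewrite /= !in_itv/= => /andP[s00 s0t] /andP[ts1 s11].
have {}s0t : s0 < t.
  rewrite lt_neqAle s0t andbT; apply/eqP => st.
  by apply: (bz u0); rewrite -as0 st.
have {}ts1 : t < s1.
  rewrite lt_neqAle ts1 andbT; apply/eqP => st.
  by apply: (bz u1); rewrite -as1 -st.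
have u01' : u0 < u1.
  rewrite lt_neqAle u10 andbT; apply/eqP => uu.
  have := ainj s0 s1; rewrite as0 as1 uu => H.
  by have := H ltac:(lra) ltac:(lra) erefl; lra.
(* Affine maps take [[-1, 1]] to [[s0, s1]] and to [[u0, u1]], as [two_arcs_simple_closed_curve]
   expects. *)
have cL (c d : R) : continuous (fun v : R => c * v + d).
  by move=> v; apply: cvgD; [exact: mulrl_continuous|exact: cvg_cst].
have itvL (c d v : R) : c < d -> -1 <= v -> v <= 1 ->
    c <= (d - c) / 2 * v + (c + d) / 2 /\ (d - c) / 2 * v + (c + d) / 2 <= d.
  by move=> cd v1 v2; split; nra.
have injL (c d v w : R) : c < d ->
    (d - c) / 2 * v + (c + d) / 2 = (d - c) / 2 * w + (c + d) / 2 -> v = w.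
  move=> cd /addIr/mulfI; apply; apply: lt0r_neq0; lra.
have endL (c d : R) : (d - c) / 2 * -1 + (c + d) / 2 = c by lra.
have endR (c d : R) : (d - c) / 2 * 1 + (c + d) / 2 = d by lra.
have s01' : s0 < s1 by lra.
pose A v := a ((s1 - s0) / 2 * v + (s0 + s1) / 2).
pose B v := b ((u1 - u0) / 2 * v + (u0 + u1) / 2).
have [||v w|v w||| |S HS] := @two_arcs_simple_closed_curve _ _ A B.
- by move=> v; apply: continuous_comp; [exact: cL|exact: ca].
- by move=> v; apply: continuous_comp; [exact: cL|exact: cb].
- rewrite !in_itv/= => /andP[v0 v1] /andP[w0 w1] vw.
  have [h1 h2] := itvL s0 s1 v ltac:(lra) v0 v1.
  have [h3 h4] := itvL s0 s1 w ltac:(lra) w0 w1.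
  by apply: (injL s0 s1) => //; apply: ainj vw; apply/andP; lra.
- rewrite !in_itv/= => /andP[v0 v1] /andP[w0 w1] vw.
  have [h1 h2] := itvL u0 u1 v ltac:(lra) v0 v1.
  have [h3 h4] := itvL u0 u1 w ltac:(lra) w0 w1.
  by apply: (injL u0 u1) => //; apply: binj vw; apply/andP; lra.
- by rewrite /A /B !endL as0.
- by rewrite /A /B !endR as1.
- move=> v w; rewrite !in_itv/= => /andP[v0 v1] /andP[w0 w1].
  have [ss0 ss1] := itvL s0 s1 v s01' v0 v1.
  have [uu0 uu1] : u0 < (u1 - u0) / 2 * w + (u0 + u1) / 2 /\
      (u1 - u0) / 2 * w + (u0 + u1) / 2 < u1 by split; nra.
  rewrite /A /B; move: (_ * v + _) ss0 ss1 => s ss0 ss1.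
  move: (_ * w + _) uu0 uu1 => u uu0 uu1 ab; have [st|ts] := leP s t.
    suff : u <= u0 by lra.
    apply: u0max; split=> /=; last by apply/andP; lra.
    by exists s => //=; rewrite in_itv/=; apply/andP; lra.
  suff : u1 <= u by lra.
  apply: u1min; split=> /=; last by apply/andP; lra.
  by exists s => //=; rewrite in_itv/=; apply/andP; lra.
- by have [_ _] := dX; apply; exists S.
Qed.

Lemma ex_arc x y : x <> y -> exists a, arc a x y.
Proof.
move=> xy.
have [|a] := @open_connected_arc _ _ setT x y dendrite_compact
  dendrite_locally_connected openT _ I I xy; last by exists a.
by have [[]] := dX.
Qed.

(** For distinct points this is the arc between them, by [seg_arc]. As an intersection it lies by
    definition in every connected set containing both ends. *)
Definition seg x y : set X :=
  \bigcap_(C in [set C : set X | [/\ connected C, C x & C y]]) C.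

Lemma seg_sub C x y : connected C -> C x -> C y -> seg x y `<=` C.
Proof. by move=> cC Cx Cy z; apply. Qed.

Lemma seg_l x y : seg x y x. Proof. by move=> C []. Qed.
Lemma seg_r x y : seg x y y. Proof. by move=> C []. Qed.

(** A connected set containing both ends but missing an interior point of the arc would contradict
    [arc_cut]. *)
Lemma seg_arc a x y : arc a x y -> seg x y = a @` `[0, 1]%classic.
Proof.
move=> aP; have [ca a0 a1 _] := aP; apply/seteqP; split.
  apply: seg_sub; first by have [] := line_segment_image 0 1 ca.
    by exists 0; rewrite //= in_itv/= lexx ler01.
  by exists 1; rewrite //= in_itv/= lexx ler01.
move=> _ [t /= + <-] C [cC Cx Cy]; rewrite in_itv/= => /andP[t0 t1].
have [->|tn0] := eqVneq t 0; first by rewrite a0.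
have [->|tn1] := eqVneq t 1; first by rewrite a1.
apply: contrapT => Ct; apply: (arc_cut (t := t) aP).
  by rewrite !lt_neqAle eq_sym tn0 t0 tn1.
by exists C => //; split=> // v Cv /= vt; apply: Ct; rewrite -vt.
Qed.

Lemma seg_refl x : seg x x = [set x].
Proof.
apply/seteqP; split; last by move=> _ ->; exact: seg_l.
by apply: seg_sub => //; exact: connected1.
Qed.

Lemma seg_connected x y : connected (seg x y).
Proof.
have [->|/eqP/ex_arc[a aP]] := eqVneq x y; first by rewrite seg_refl; exact: connected1.
by rewrite (seg_arc aP); have [ca _ _ _] := aP; have [] := line_segment_image 0 1 ca.
Qed.

Lemma seg_closed x y : closed (seg x y).
Proof.
have [->|/eqP/ex_arc[a aP]] := eqVneq x y.
  rewrite seg_refl; apply: accessible_closed_set1.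
  exact/hausdorff_accessible/metric_hausdorff.
rewrite (seg_arc aP); have [ca _ _ _] := aP.
by have [+ _] := line_segment_image 0 1 ca; apply: compact_closed;
  exact: metric_hausdorff.
Qed.

(** The empty set and the whole dendrite are allowed, so that preimages under monotone maps stay in
    the class. *)
Definition halfspace H := connected H /\ connected (~` H).

(* With representatives [a], [b], [c], [d] of the four quadrants, [seg a c] lies in
   [seg a b `|` seg b c] and in [seg a d `|` seg d c], but [seg a b] misses
   [seg c d] and [seg b c] misses [seg a d], which disconnects [seg a c] *)
Lemma halfspace_quadrants H1 H2 a b c d : halfspace H1 -> halfspace H2 ->
  H1 a -> H2 a -> H1 b -> ~ H2 b -> ~ H1 c -> ~ H2 c -> ~ H1 d -> H2 d -> False.
Proof.
move=> [cH1 cH1'] [cH2 cH2'] a1 a2 b1 b2 c1 c2 d1 d2.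
have ab := seg_sub cH1 a1 b1; have cd := seg_sub cH1' c1 d1.
have bc := seg_sub cH2' b2 c2; have ad := seg_sub cH2 a2 d2.
have abc : seg a c `<=` seg a b `|` seg b c.
  apply: seg_sub; [|by left; exact: seg_l|by right; exact: seg_r].
  by apply: connectedU => //; [exists b; split; [exact: seg_r|exact: seg_l]|..];
    exact: seg_connected.
have adc : seg a c `<=` seg a d `|` seg c d.
  apply: seg_sub; [|by left; exact: seg_l|by right; exact: seg_l].
  by apply: connectedU => //; [exists d; split; exact: seg_r|..];
    exact: seg_connected.
have split_ac z : seg a c z -> (seg a b `&` seg a d) z \/ (seg b c `&` seg c d) z.
  move=> zac; case: (abc z zac) => h1; case: (adc z zac) => h2;
    [by left|by have := cd _ h2; have := ab _ h1|
     by have := bc _ h1; have := ad _ h2|by right].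
have H := @seg_connected a c (seg a c `&` (seg a b `&` seg a d)).
have [_ [bcc _]] : (seg a c `&` (seg a b `&` seg a d)) c.
  rewrite H; first exact: seg_r.
  - by exists a; split; [exact: seg_l|split; exact: seg_l].
  - exists (~` (seg b c `&` seg c d)).
      by apply: closed_openC; apply: closedI; exact: seg_closed.
    apply/seteqP; split=> z [zac].
      move=> [zab zad]; split=> // -[zbc _].
      by have := bc _ zbc; have := ad _ zad.
    by move=> nz; split=> //; case: (split_ac z zac).
  - by exists (seg a b `&` seg a d) => //; apply: closedI; exact: seg_closed.
by have := ab _ bcc.
Qed.

End dendrite_structure.

Lemma compact_open_dist (R : realType) (X : metricType R) (A U : set X) :
  compact A -> open U -> A `<=` U ->
  exists2 d : R, 0 < d & forall u v, A u -> ~ U v -> d <= mdist u v.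
Proof.
move=> cA oU AU; apply: contrapT => H.
pose B (d : R) : set X := [set u | exists2 v, A u & ~ U v /\ mdist u v < d].
have [|||p Ap Hp] := @compact_filter_from _ R [set d | 0 < d] B A cA.
- by exists 1 => /=.
- move=> i j /= i0 j0; exists (Num.min i j); first by rewrite /= lt_min i0.
  move=> u [v Au []]; rewrite lt_min => Uv /andP[ui uj].
  by split; exists v.
- move=> d d0; apply: contrapT => /nonemptyPn AB; apply: H; exists d => //.
  move=> u v Au Uv; rewrite leNgt; apply/negP => uv.
  have : (A `&` B d) u by split=> //; exists v.
  by rewrite AB.
have [e e0 He] := (iffLR (open_mdist U)) oU p (AU _ Ap).
have e20 : 0 < e / 2 by lra.
have [|u [[v Au [Uv uv]] /= pu]] := Hp _ e20 [set y | mdist p y < e / 2].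
  by apply: open_nbhs_nbhs; split; [exact: open_mdist_ball|rewrite /= mdistxx].
by apply: Uv; apply: He; have := metric_triangle p u v; lra.
Qed.

(** * Separation by halfspaces, gates, and endpoints of trees *)

Section dendrite_separation.
Context {R : realType} {X : metricType R}.
Hypothesis dX : dendrite [set: X].
Implicit Types (x y z p q : X) (A B C H U : set X).

Let closed1 z : closed [set z].
Proof.
apply: accessible_closed_set1; exact/hausdorff_accessible/metric_hausdorff.
Qed.

(** The complement is a union of arcs ending at [z]. An arc from [v] to [z] that met the component
    would do so before reaching [z], and its part up to there would put [v] in the component. *)
Lemma component_halfspace z p : halfspace (connected_component (~` [set z]) p).
Proof.
set C := connected_component _ _; split; first exact: component_connected.
have Cz : ~ C z by move=> /connected_component_sub; apply.
have H v : ~ C v -> exists S : set X, [/\ connected S, S v, S z & S `<=` ~` C].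
  move=> Cv; have [->|/eqP vz] := eqVneq v z.
    by exists [set z]; split=> //; [exact: connected1|move=> _ ->].
  have [a aP] := ex_arc dX vz; have [ca a0 a1 ainj] := aP.
  exists (a @` `[0, 1]%classic); split; first by have [] := line_segment_image 0 1 ca.
  - by exists 0; rewrite //= in_itv/= lexx ler01.
  - by exists 1; rewrite //= in_itv/= lexx ler01.
  move=> _ [t /= + <-] Ct; rewrite in_itv/= => /andP[t0 t1].
  have tn1 : t < 1.
    by rewrite lt_neqAle t1 andbT; apply/eqP => t1'; apply: Cz; rewrite -a1 -t1'.
  apply: Cv; apply: connected_component_trans Ct _.
  exists (a @` `[0, t]%classic); last by exists 0; rewrite //= in_itv/= lexx.
  split; [by exists t; rewrite //= in_itv/= t0 lexx| |
    by have [] := line_segment_image 0 t ca].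
  move=> _ [s /= + <-] sz; rewrite in_itv/= => /andP[s0 st].
  have := ainj s 1; rewrite sz a1 => /(_ ltac:(apply/andP; lra) ltac:(apply/andP; lra) erefl).
  lra.
have /choice[S HS] : forall v, exists S : set X,
    ~ C v -> [/\ connected S, S v, S z & S `<=` ~` C].
  by move=> v; have [/H[S ?]|nv] := pselect (~ C v); [exists S|exists set0].
rewrite (_ : ~` C = \bigcup_(v in ~` C) S v).
  apply: bigcup_connected; last by move=> v /HS[].
  by exists z => v /HS[].
apply/seteqP; split=> [v Cv|w [v /HS[_ _ _ + Sw]]]; last by apply.
by exists v => //; have [] := HS v Cv.
Qed.

(** Cut an arc from [p] to [q] at one third and at two thirds, and take the components of [p]. The
    closure of [H1] adds at most the point [z1], which lies in [H2]; so it is a compact subset of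
    the open set [H2], at positive distance from its complement. *)
Lemma halfspace_separation p q : p <> q -> exists H1 H2, [/\ halfspace H1,
  halfspace H2, nbhs p H1, nbhs q (~` H2) &
  exists2 d : R, 0 < d & forall u v, H1 u -> ~ H2 v -> d <= mdist u v].
Proof.
move=> pq; have [a aP] := ex_arc dX pq; have [ca a0 a1 ainj] := aP.
pose z1 := a (1 / 3); pose z2 := a (2 / 3).
have o1 : open (~` [set z1]) by exact: closed_openC.
have o2 : open (~` [set z2]) by exact: closed_openC.
pose H1 := connected_component (~` [set z1]) p.
pose H2 := connected_component (~` [set z2]) p.
have sub (s t r : R) : 0 <= s -> t <= 1 -> 0 <= r <= 1 ->
    (t < r \/ r < s) -> a @` `[s, t]%classic `<=` ~` [set a r].
  move=> s0 t1 r01 tr _ [u /= + <-] /= ur; rewrite in_itv/= => /andP[su ut].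
  have := ainj u r ltac:(apply/andP; lra) r01 ur; lra.
have img (s t r : R) : s <= r -> r <= t -> (a @` `[s, t]%classic) (a r).
  by move=> sr rt; exists r; rewrite //= in_itv/= sr.
have q1 : ~ H1 q by apply: arc_cut aP _ => //; apply/andP; lra.
have q2 : ~ H2 q by apply: arc_cut aP _ => //; apply/andP; lra.
have p1 : H1 p.
  by apply: connected_component_refl; rewrite -a0; apply: (sub 0 0); [..|apply: img]; lra.
have p2 : H2 p.
  by apply: connected_component_refl; rewrite -a0; apply: (sub 0 0); [..|apply: img]; lra.
have z1H2 : H2 z1.
  exists (a @` `[0, 1 / 3]%classic); last by apply: img; lra.
  split; [by rewrite -a0; apply: img; lra|by apply: sub; lra|].
  by have [] := line_segment_image 0 (1 / 3) ca.
have z2H1 : ~ H1 z2.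
  move=> h; apply: q1; apply: connected_component_trans h _.
  exists (a @` `[2 / 3, 1]%classic); last by rewrite -a1; apply: img; lra.
  split; [by apply: img; lra|by apply: sub; lra|].
  by have [] := line_segment_image (2 / 3) 1 ca.
have H12 : H1 `<=` H2.
  apply: connected_component_max => //; last exact: component_connected.
  by move=> u Hu /= uz; apply: z2H1; rewrite -uz.
have clH1 : closure H1 `<=` H2.
  move=> v Hv; have [->//|vz] := eqVneq v z1.
  apply: H12; pose D := connected_component (~` [set z1]) v.
  have Dv : D v by apply: connected_component_refl; apply/eqP.
  have [u [H1u Du]] := Hv D (open_nbhs_nbhs (conj (component_open dX v o1) Dv)).
  apply: connected_component_trans H1u _; exact: connected_component_sym.
exists H1, H2; split; [exact: component_halfspace|exact: component_halfspace| | |].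
- by apply: open_nbhs_nbhs; split=> //; exact: component_open.
- apply: filterS (_ : nbhs q (connected_component (~` [set z2]) q)).
    move=> v qv pv; apply: q2; apply: connected_component_trans pv _.
    exact: connected_component_sym.
  apply: open_nbhs_nbhs; split; first exact: component_open.
  by apply: connected_component_refl; rewrite -a1; apply: (sub 1 1); [..|apply: img]; lra.
- have cH1 : compact (closure H1).
    by rewrite -(setTI (closure H1)); apply: compact_closedI;
      [exact: dendrite_compact|exact: closed_closure].
  have [d d0 Hd] := compact_open_dist cH1 (component_open dX p o2) clH1.
  by exists d => // u v Hu Hv; apply: Hd => //; exact: subset_closure.
Qed.

(** The pairs of points at distance at least [e] form a compact subset of the square, and each pair
    separated by [halfspace_separation] has a product neighbourhood separated by the same
    halfspaces. *)
Lemma separating_halfspaces (e : R) : 0 < e -> exists (E : {fset X * X})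
    (H1 H2 : X * X -> set X),
  [/\ forall i, i \in E -> halfspace (H1 i) /\ halfspace (H2 i),
      exists2 d : R, 0 < d & forall i, i \in E ->
        forall u v, H1 i u -> ~ H2 i v -> d <= mdist u v &
      forall p q, e <= mdist p q -> exists2 i, i \in E & H1 i p /\ ~ H2 i q].
Proof.
move=> e0.
pose P (i : X * X) (H : set X * set X * R) := [/\ halfspace H.1.1,
  halfspace H.1.2, nbhs i.1 H.1.1, nbhs i.2 (~` H.1.2) &
  0 < H.2 /\ forall u v, H.1.1 u -> ~ H.1.2 v -> H.2 <= mdist u v].
have /choice[H HP] : forall i, exists K, i.1 <> i.2 -> P i K.
  move=> [p q]; have [pq|/eqP pq] := eqVneq p q; first by exists (set0, set0, 0).
  have [H1 [H2 [h1 h2 h3 h4 [d d0 hd]]]] := halfspace_separation pq.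
  by exists (H1, H2, d) => _; split.
pose D : set (X * X) := [set i | e <= mdist i.1 i.2].
have DP i : D i -> P i (H i).
  by move=> Di; apply: HP => i12; move: Di; rewrite /D/= i12 mdistxx; lra.
pose f i : set (X * X) := interior (H i).1.1 `*` interior (~` (H i).1.2).
have oD : open (~` D).
  rewrite openE => -[p q] /= /negP; rewrite -ltNge => pq.
  pose r := (e - mdist p q) / 2; have r0 : 0 < r by rewrite /r; lra.
  exists ([set y | mdist p y < r], [set y | mdist q y < r]).
    by split; apply: open_nbhs_nbhs; split; [exact: open_mdist_ball| |
      exact: open_mdist_ball|]; rewrite /= mdistxx.
  move=> [u v] [/= pu qv]; rewrite /D/=; apply/negP; rewrite -ltNge.
  have := metric_triangle u p v; have := metric_triangle p q v.
  by rewrite (metric_sym u p); move: pu qv; rewrite /r; lra.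
have cD : compact D.
  rewrite -(setTI D) -setXTT; apply: compact_closedI; last by rewrite -openC.
  by apply: compact_setX; exact: dendrite_compact.
have [||E ED DE] := @compact_finite_cover _ _ D f D cD.
- move=> i _; rewrite openE => -[u v] [/= hu hv].
  by exists (interior (H i).1.1, interior (~` (H i).1.2)) => //;
    split; apply: open_nbhs_nbhs; split=> //; exact: open_interior.
- by move=> i Di; exists i => //; have [_ _ ? ? _] := DP _ Di.
exists E, (fun i => (H i).1.1), (fun i => (H i).1.2); split.
- by move=> i /ED/DP[].
- have [d d0 Hd] : exists2 d : R, 0 < d & forall i, i \in enum_fset E -> d <= (H i).2.
    have: {in enum_fset E, forall i, 0 < (H i).2} by move=> i /ED/DP[_ _ _ _ []].
    elim: (enum_fset E) => [|i s IH] Hs; first by exists 1.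
    have [|d d0 Hd] := IH; first by move=> j js; apply: Hs; rewrite inE js orbT.
    have Hi : 0 < (H i).2 by apply: Hs; rewrite inE eqxx.
    exists (Num.min d (H i).2); first by rewrite lt_min d0.
    move=> j; rewrite inE => /predU1P[->|/Hd]; first by rewrite ge_min lexx orbT.
    by move=> dj; rewrite ge_min dj.
  exists d => // i iE u v hu hv; apply: le_trans (Hd _ iE) _.
  by have [_ _ _ _ [_ ->]] := DP i (ED _ iE).
- move=> p q pq; have [i iE [/= hp hq]] := DE (p, q) pq.
  by exists i => //; split; [exact: interior_subset hp|exact: (interior_subset hq)].
Qed.

(* The first point of [B] on an arc from [a] lies between [a] and all of [B] *)
Lemma gate a B : closed B -> connected B -> B !=set0 -> ~ B a ->
  exists2 b0, B b0 & forall b, B b -> seg a b b0.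
Proof.
move=> clB cB [b1 Bb1] Ba; have ab1 : a <> b1 by move=> h; apply: Ba; rewrite h.
have [g gP] := ex_arc dX ab1; have [cg g0 g1 ginj] := gP.
have clgB : closed (g @^-1` B) by apply: preimage_closed => // t _; exact: cg.
have [|t [Bt /andP[t0 t1]] tmin] := compact_min (@closed_itv_compact _ _ 0 1 clgB).
  by exists 1; split; rewrite /= ?g1// ler01 lexx.
exists (g t) => // b Bb.
have sub : seg a (g t) `<=` g @` `[0, t]%classic.
  apply: seg_sub; first by have [] := line_segment_image 0 t cg.
    by exists 0; rewrite //= in_itv/= lexx.
  by exists t; rewrite //= in_itv/= t0 lexx.
have cov : seg a (g t) `<=` seg a b `|` B.
  apply: seg_sub; [|by left; exact: seg_l|by right].
  apply: connectedU => //; last exact: seg_connected.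
  by exists b; split=> //; exact: seg_r.
apply: contrapT => nb.
have dis z : seg a (g t) z -> B z -> z = g t.
  move=> /sub[s /= + <-] Bs; rewrite in_itv/= => /andP[s0 st].
  have : t <= s by apply: tmin; split=> //=; apply/andP; lra.
  by move=> ts; congr g; apply/le_anti; rewrite st ts.
(* If [b] were a counterexample, the part of [seg a (g t)] in [seg a b] would be its part off [B],
   thus closed and open in it; being nonempty it would be everything, [g t] included. *)
have : (seg a (g t) `&` seg a b) (g t).
  rewrite (seg_connected dX (x := a) (y := g t) (B := seg a (g t) `&` seg a b)).
  - exact: seg_r.
  - by exists a; split; exact: seg_l.
  - exists (~` B); first exact: closed_openC.
    apply/seteqP; split=> z [sz].
      by move=> zb; split=> // Bz; apply: nb; rewrite -(dis z).
    by move=> Bz; split=> //; have [] := cov _ sz.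
  - by exists (seg a b) => //; exact: seg_closed.
by move=> [].
Qed.

(* Order [A] by [u <= v] iff [u] lies in [seg x v], for a base point [x] which is
   outside [H] if possible: the maximal points are endpoints *)
Lemma endpoint_halfspace A H : tree A -> halfspace H -> (A `&` H) !=set0 ->
  (endpoint A `&` H) !=set0.
Proof.
move=> [[[A0 cA conA] _ _] _] [cH cH'] [u0 [Au0 Hu0]].
have [x Ax Hx] : exists2 x, A x & H x -> A `<=` H.
  have [AH|/existsNP[x /not_implyP[Ax nHx]]] := pselect (A `<=` H).
    by exists u0.
  by exists x => // /nHx.
have trans u v w : seg x v u -> seg x w v -> seg x w u.
  move=> xvu xwv; apply: seg_sub xvu => //; [exact: seg_connected|exact: seg_l].
(* On an arc from [x] to [u], the point [v] has some parameter [t], and [u] lies in the part up to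
   [t]; injectivity forces [t = 1]. *)
have anti u v : seg x v u -> seg x u v -> u = v.
  move=> xvu xuv; have [xu|/eqP xu] := eqVneq x u.
    by move: xuv; rewrite -xu seg_refl.
  have [g gP] := ex_arc dX xu; have [cg g0 g1 ginj] := gP.
  move: xuv; rewrite (seg_arc dX gP) => -[t /=]; rewrite in_itv/= => /andP[t0 t1] gt.
  have : (g @` `[0, t]%classic) u.
    apply: (@seg_sub _ _ _ x v) xvu; first by have [] := line_segment_image 0 t cg.
      by exists 0; rewrite //= in_itv/= lexx.
    by exists t; rewrite //= in_itv/= t0 lexx.
  move=> [s /=]; rewrite in_itv/= => /andP[s0 st] gs.
  have := ginj s 1; rewrite gs g1 => /(_ ltac:(apply/andP; lra) ltac:(apply/andP; lra) erefl) s1.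
  by rewrite -gt -g1; congr g; lra.
(* The upper bounds of [s] form a closed set, so compactness of [A] gives an upper bound of a
   chain. *)
have cK s : closed [set v | seg x v s].
  rewrite (_ : [set v | _] = ~` connected_component (~` [set s]) x).
    by apply: open_closedC; apply: component_open => //; exact: closed_openC.
  apply/seteqP; split=> v /=.
    move=> xvs [C [Cx Cs cC Cv]]; exact: (Cs s (seg_sub cC Cx Cv xvs)).
  move=> nC; apply: contrapT => xvs; apply: nC; exists (seg x v).
    split; [exact: seg_l|by move=> w xvw /= ws; apply: xvs; rewrite -ws|].
    exact: seg_connected.
  exact: seg_r.
pose T := {v | A v /\ seg x v u0}.
pose mk v (h : A v /\ seg x v u0) : T := exist _ v h.
pose r (u v : T) := `[< seg x (sval v) (sval u) >].
have u0T : A u0 /\ seg x u0 u0 by split=> //; exact: seg_r.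
have [|u v w /asboolP uv /asboolP vw|F tF|[e [Ae u0e]] emax] :=
    @ZL_preorder T (mk _ u0T) r.
- by move=> v; apply/asboolP; exact: seg_r.
- by apply/asboolP; exact: trans vw.
- have [[s0 Fs0]|F0] := pselect (F !=set0); last first.
    by exists (mk _ u0T) => s Fs; case: F0; exists s.
  have [||||t At Ht] := @compact_chain _
      [set K | exists2 s : T, F s & K = [set v | seg x v (sval s)]] A cA.
  + by exists [set v | seg x v (sval s0)], s0.
  + move=> _ _ [s Fs ->] [t Ft ->].
    have [/asboolP st|/asboolP ts] := tF s t Fs Ft; [right|left] => v /=.
      exact: trans.
    exact: trans.
  + by move=> _ [s _ ->]; exact: cK.
  + move=> _ [s _ ->]; exists (sval s); split; last exact: seg_r.
    by have [] := svalP s.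
  have u0t : seg x t u0.
    apply: (trans _ (sval s0)); first by have [] := svalP s0.
    by apply: (Ht [set v | seg x v (sval s0)]); exists s0.
  exists (mk _ (conj At u0t)) => s Fs; apply/asboolP => /=.
  by apply: (Ht [set v | seg x v (sval s)]); exists s.
have {}emax v : A v -> seg x v e -> v = e.
  move=> Av xve; have u0v : seg x v u0 by exact: trans xve.
  have /asboolP/= xev : r (mk _ (conj Av u0v)) (mk _ (conj Ae u0e)).
    by apply: emax; apply/asboolP.
  exact: anti.
(* If [x] is outside [H] and [e] were too, [seg x e] would avoid [H], although it contains [u0]. *)
exists e; split; last first.
  have [/Hx|Hx'] := pselect (H x); first exact.
  by apply: contrapT => He; have := seg_sub cH' Hx' He u0e.
split=> //; have [xe|/eqP xe] := eqVneq x e; [right|left].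
  apply/seteqP; split=> [v Av|_ ->//]; apply: emax => //.
  by rewrite -xe; exact: seg_l.
split; first by exists x; split.
(* Segments from [x] to points of [A] other than [e] stay in [A] and avoid [e] by maximality. *)
rewrite (_ : A `\ e = \bigcup_(v in A `\ e) seg x v).
  apply: bigcup_connected; first by exists x => v _; exact: seg_l.
  by move=> v _; exact: seg_connected.
apply/seteqP; split=> [v Aev|w [v [Av ve] xvw]].
  by exists v => //; exact: seg_r.
split; first exact: seg_sub xvw.
by move=> /= we; apply: ve; apply: emax => //; rewrite -we.
Qed.

End dendrite_separation.

(** * Eventually periodic sets of times *)

Section eventually_periodic.
Implicit Types (S T : nat -> Prop).

Definition evp S := exists N p : nat, (0 < p)%N /\
  forall k, (N <= k)%N -> S (k + p)%N <-> S k.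

Lemma evp_iter S N p j : (forall k, (N <= k)%N -> S (k + p)%N <-> S k) ->
  forall k, (N <= k)%N -> S (k + j * p)%N <-> S k.
Proof.
move=> H k Nk; elim: j => [|j IH]; first by rewrite mul0n addn0.
by rewrite mulSn (addnC p) addnA H// (leq_trans Nk)// leq_addr.
Qed.

Lemma evp2 (op : Prop -> Prop -> Prop) S T :
  (forall a b c d : Prop, a <-> c -> b <-> d -> op a b <-> op c d) ->
  evp S -> evp T -> evp (fun k => op (S k) (T k)).
Proof.
move=> opP [N [p [p0 HS]]] [M [q [q0 HT]]].
exists (maxn N M), (p * q)%N; split; first by rewrite muln_gt0 p0.
move=> k; rewrite geq_max => /andP[Nk Mk]; apply: opP.
  by rewrite mulnC; exact: evp_iter HS _ Nk.
exact: evp_iter HT _ Mk.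
Qed.

Lemma evp_not S : evp S -> evp (fun k => ~ S k).
Proof.
by move=> [N [p [p0 H]]]; exists N, p; split=> // k Nk; rewrite H.
Qed.

Lemma evp_and S T : evp S -> evp T -> evp (fun k => S k /\ T k).
Proof. by apply: evp2 => a b c d ac bd; rewrite ac bd. Qed.

Lemma evp_or S T : evp S -> evp T -> evp (fun k => S k \/ T k).
Proof. by apply: evp2 => a b c d ac bd; rewrite ac bd. Qed.

Lemma evp_ext S T : (forall k, S k <-> T k) -> evp S -> evp T.
Proof.
by move=> ST [N [p [p0 H]]]; exists N, p; split=> // k Nk; rewrite -!ST H.
Qed.

Lemma evp_exists (I : eqType) (s : seq I) (S : I -> nat -> Prop) :
  (forall i, evp (S i)) -> evp (fun k => exists2 i, i \in s & S i k).
Proof.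
move=> HS; elim: s => [|i s IH].
  by exists 0%N, 1%N; split=> // k _; split=> -[i]; rewrite in_nil.
apply: evp_ext (evp_or (HS i) IH) => k; split=> [[Si|[j js Sj]]|[j]].
- by exists i => //; rewrite inE eqxx.
- by exists j => //; rewrite inE js orbT.
- by rewrite inE => /predU1P[->|js] Sj; [left|right; exists j].
Qed.

(** In a residue class modulo [p], membership persists once it occurs; a class without members is
    constant anyway. *)
Lemma evp_homo S p : (0 < p)%N -> (forall k, S k -> S (k + p)%N) -> evp S.
Proof.
move=> p0 H.
have Hj j k : S k -> S (k + j * p)%N.
  by move=> Sk; elim: j => [|j IH]; [rewrite addn0|rewrite mulSn (addnC p) addnA; exact: H].
have /choice[N HN] : forall r, exists N : nat, forall k, (N <= k)%N -> (k %% p)%N = r ->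
    S (k + p)%N -> S k.
  move=> r; have [[k0 [k0r Sk0]]|nS] := pselect (exists k0, (k0 %% p)%N = r /\ S k0).
    exists k0 => k k0k kr _; have /dvdnP[j kj] : (p %| k - k0)%N.
      by rewrite -eqn_mod_dvd// kr k0r.
    by rewrite -(subnKC k0k) kj; exact: Hj.
  by exists 0%N => k _ kr Skp; case: nS; exists (k + p)%N; rewrite modnDr.
exists (\max_(r < p) N r)%N, p; split=> // k Nk; split=> [|/H//].
apply: (HN (k %% p)%N) => //; apply: leq_trans Nk.
exact: (leq_bigmax (Ordinal (ltn_pmod k p0))).
Qed.

Lemma evp_anti S p : (0 < p)%N -> (forall k, S (k + p)%N -> S k) -> evp S.
Proof.
move=> p0 H; have := @evp_homo (fun k => ~ S k) p p0.
move=> /(_ (fun k nSk Skp => nSk (H k Skp)))/evp_not; apply: evp_ext => k.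
by split=> [/contrapT|Sk /(_ Sk)].
Qed.

(** For each shift one of four inclusions holds between the set or its complement and the shifted
    set or its complement. The shift 1 settles the matter at once, unless the set or its complement
    never contains two consecutive times; [alternate] treats that case. *)
Lemma evp_shift S :
  (forall p, (0 < p)%N -> [\/ forall k, S k -> S (k + p)%N,
    forall k, S (k + p)%N -> S k, forall k, ~ S k -> S (k + p)%N |
    forall k, S k -> ~ S (k + p)%N]) -> evp S.
Proof.
have alternate T : (forall k, T k -> ~ T k.+1) ->
  (forall p, (0 < p)%N -> [\/ forall k, T k -> T (k + p)%N,
    forall k, T (k + p)%N -> T k, forall k, ~ T k -> T (k + p)%N |
    forall k, T k -> ~ T (k + p)%N]) -> evp T.
  move=> T1 HT; apply: contrapT => nT.
  have never p : (0 < p)%N -> forall k, T k -> ~ T (k + p)%N.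
    move=> p0; have [h|h|h|//] := HT p p0; exfalso; apply: nT.
    - exact: evp_homo h.
    - exact: evp_anti h.
    (* If [k] is not in [T] then [k + p] is, so [k + p.+1] is not: shifting back by [p.+1] preserves
       [T]. Only the fourth alternative is left for every [p], and then [T] has at most one
       element. *)
    - apply: (@evp_anti _ p.+1) => // k; rewrite addnS => Tkp.
      by apply: contrapT => /h/T1.
  apply: nT; have [[k0 Tk0]|nT] := pselect (exists k, T k).
    exists k0.+1, 1%N; split=> // k k0k.
    have nTk j : (k0 < j)%N -> ~ T j.
      by move=> kj; have := never (j - k0)%N ltac:(lia) k0 Tk0; rewrite subnKC// ltnW.
    by split=> Tk; exfalso; [apply: (nTk (k + 1)%N) Tk|apply: (nTk k) Tk]; lia.
  by exists 0%N, 1%N; split=> // k _; split=> Tk; case: nT; [exists (k + 1)%N|exists k].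
move=> HS; have [h|h|h|h] := HS 1%N isT.
- exact: evp_homo h.
- exact: evp_anti h.
- suff : evp (fun k => ~ S k).
    by move/evp_not; apply: evp_ext => k; split=> [/contrapT|Sk /(_ Sk)].
  apply: alternate => [k nSk|p p0]; first by apply; rewrite -addn1; exact: h.
  have [h'|h'|h'|h'] := HS p p0.
  + by apply: Or42 => k nSkp Sk; apply/nSkp/h'.
  + by apply: Or41 => k nSk Skp; apply/nSk/h'.
  + by apply: Or44 => k nSk; apply; exact: h'.
  + by apply: Or43 => k /contrapT; exact: h'.
- by apply: alternate => // k Sk; have := h k Sk; rewrite addn1.
Qed.

End eventually_periodic.

(** * The Hausdorff distance *)

Section hausdorff.
Context {R : realType} {X : metricType R}.
Hypothesis cX : compact [set: X].
Implicit Types (A B : set X) (e : R).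

Let swap A B : [set inf [set mdist a b | a in A] | b in B] =
  [set inf [set mdist b a | a in A] | b in B].
Proof.
congr image; apply/funext => b; congr inf; congr image.
by apply/funext => a; exact: metric_sym.
Qed.

Lemma hausdorff_distC A B : hausdorff_dist A B = hausdorff_dist B A.
Proof. by rewrite /hausdorff_dist maxC (swap A B) (swap B A). Qed.

Let inf_bounds A : A !=set0 -> exists2 D : R, 0 <= D &
  forall x, 0 <= inf [set mdist x b | b in A] <= D.
Proof.
move=> [b Ab]; have [D D0 HD] := compact_mdist_bounded cX; exists D => // x.
apply/andP; split.
  by apply: lb_le_inf; [exists (mdist x b), b|move=> _ [c _ <-]; exact: mdist_ge0].
apply: le_trans (HD x b I I); apply: ge_inf; last by exists b.
by exists 0 => _ [c _ <-]; exact: mdist_ge0.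
Qed.

Lemma hausdorff_dist_has_sup A B : A !=set0 -> B !=set0 ->
  has_sup [set inf [set mdist a b | b in B] | a in A].
Proof.
move=> [a Aa] B0; have [D D0 HD] := inf_bounds B0.
split; first by exists (inf [set mdist a b | b in B]), a.
by exists D => _ [c _ <-]; have /andP[] := HD c.
Qed.

Lemma hausdorff_dist_ge0 A B : A !=set0 -> B !=set0 -> 0 <= hausdorff_dist A B.
Proof.
move=> A0 B0; rewrite le_max; apply/orP; left.
have [a Aa] := A0; have [D D0 HD] := inf_bounds B0.
apply: le_trans (_ : inf [set mdist a b | b in B] <= _).
  by have /andP[] := HD a.
by apply: ub_le_sup; [have [] := hausdorff_dist_has_sup A0 B0|exists a].
Qed.

Lemma hausdorff_dist_lt A B e a : B !=set0 -> hausdorff_dist A B < e -> A a ->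
  exists2 b, B b & mdist a b < e.
Proof.
move=> B0; rewrite /hausdorff_dist gt_max => /andP[sA _] Aa.
have A0 : A !=set0 by exists a.
have : inf [set mdist a b | b in B] < e.
  apply: le_lt_trans sA; apply: ub_le_sup; last by exists a.
  by have [] := hausdorff_dist_has_sup A0 B0.
move=> /inf_lt[|_ [b Bb <-] ae]; last by exists b.
by have [b Bb] := B0; exists (mdist a b), b.
Qed.

Lemma hausdorff_dist_gt A B e : A !=set0 -> B !=set0 ->
  e < hausdorff_dist A B ->
  (exists2 a, A a & forall b, B b -> e <= mdist a b) \/
  (exists2 b, B b & forall a, A a -> e <= mdist b a).
Proof.
have H A' B' : A' !=set0 -> B' !=set0 ->
    e < sup [set inf [set mdist a b | b in B'] | a in A'] ->
    exists2 a, A' a & forall b, B' b -> e <= mdist a b.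
  move=> [a0 Aa0] B0 /sup_gt[|_ [a Aa <-] ea].
    by exists (inf [set mdist a0 b | b in B']), a0.
  exists a => // b Bb; apply: le_trans (ltW ea) _; apply: ge_inf; last by exists b.
  by exists 0 => _ [c _ <-]; exact: mdist_ge0.
move=> A0 B0; rewrite lt_max => /orP[/(H _ _ A0 B0) h|h]; first by left.
by right; apply: H => //; rewrite -swap.
Qed.

End hausdorff.

(** * Absence of Li-Yorke pairs *)

Lemma iter_induced_map (R : realType) (X : metricType R) (f : X -> X) k A :
  iter k (induced_map f) A = iter k f @` A.
Proof.
elim: k => [|k IH]; first by rewrite /= image_id.
by rewrite iterS IH /induced_map image_comp.
Qed.

Lemma iter_continuous (T : topologicalType) (f : T -> T) k :
  continuous f -> continuous (iter k f).
Proof.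
move=> cf; elim: k => [|k IH] x; first exact: cvg_id.
by apply: (continuous_comp (f := iter k f)); [exact: IH|exact: cf].
Qed.

Section monotone_dynamics.
Context {R : realType} {X : metricType R}.
Hypothesis dX : dendrite [set: X].
Variable f : X -> X.
Hypothesis cf : continuous f.
Hypothesis mf : monotone_map f.
Implicit Types (A B H : set X) (e d : R).

Let cX : compact [set: X]. Proof. exact: dendrite_compact. Qed.

Lemma halfspace_preimage_iter H p : halfspace H -> halfspace (iter p f @^-1` H).
Proof.
elim: p H => [|p IH] H hH //.
apply: (IH (f @^-1` H)).
by have [h1 h2] := hH; split; [exact: mf h1|exact: mf h2].
Qed.

(** [H] and its preimage under the [p]-th iterate are halfspaces, so one of their quadrants is
    empty; the four possibilities are the alternatives of [evp_shift]. *)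
Lemma evp_itinerary H x : halfspace H -> evp (fun k => H (iter k f x)).
Proof.
move=> hH; apply: evp_shift => p p0.
have itE k : iter (k + p) f x = iter p f (iter k f x) by rewrite addnC iterD.
have hHp := halfspace_preimage_iter p hH.
have [h|/existsNP[b /not_implyP[b1 b2]]] :=
  pselect (forall y, H y -> H (iter p f y)).
  by apply: Or41 => k; rewrite itE; exact: h.
have [h|/existsNP[d /not_implyP[d1 d2]]] :=
  pselect (forall y, H (iter p f y) -> H y).
  by apply: Or42 => k; rewrite itE; exact: h.
have [h|/existsNP[c /not_implyP[c1 c2]]] :=
  pselect (forall y, ~ H y -> H (iter p f y)).
  by apply: Or43 => k; rewrite itE; exact: h.
have [h|/existsNP[a /not_implyP[a1 /contrapT a2]]] :=
  pselect (forall y, H y -> ~ H (iter p f y)).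
  by apply: Or44 => k; rewrite itE; exact: h.
by exfalso; exact: (halfspace_quadrants dX hH hHp a1 a2 b1 b2 c1 c2 d2 d1).
Qed.

(** Pulling [H] back instead of pushing [A] forward makes the endpoints of [A] itself decide for
    every [k]. *)
Lemma hits_endpoint A H k : tree A -> halfspace H ->
  (iter k f @` A `&` H) !=set0 <-> exists2 p, endpoint A p & H (iter k f p).
Proof.
move=> tA hH; split=> [[_ [[a Aa <-] Ha]]|[p [Ap _] Hp]]; last first.
  by exists (iter k f p); split=> //; exists p.
have [|p [pA Hp]] := endpoint_halfspace dX tA (halfspace_preimage_iter k hH).
  by exists a.
by exists p.
Qed.

Lemma evp_hits A H : tree A -> halfspace H ->
  evp (fun k => (iter k f @` A `&` H) !=set0).
Proof.
move=> tA hH; have [_ /finite_seqP[s sE]] := tA.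
apply: (evp_ext _ (evp_exists s (fun p => evp_itinerary p hH))) => k.
rewrite (hits_endpoint k tA hH) sE.
by split=> -[p ? ?]; exists p.
Qed.

Lemma iter_unif p d : 0 < d -> exists2 e, 0 < e & forall s, (s <= p)%N ->
  forall x y : X, mdist x y < e -> mdist (iter s f x) (iter s f y) < d.
Proof.
move=> d0; elim: p => [|p [e1 e10 H1]].
  by exists d => // s; rewrite leqn0 => /eqP ->.
have [e2 e20 H2] := compact_unif cX (iter_continuous (k := p.+1) cf) d0.
exists (Num.min e1 e2); first by rewrite lt_min e10.
move=> s sp x y; rewrite lt_min => /andP[xy1 xy2].
move: sp; rewrite leq_eqVlt => /predU1P[->|sp]; last exact: H1.
by apply: H2 => //; rewrite ballEmdist.
Qed.

(** Separation by the pair is eventually periodic, so if it occurs late once, it recurs every [p]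
    steps. After a time when the images are very close it recurs within [p] steps, too soon for
    points to get [d] apart. *)
Lemma proximal_not_separated A B H1 H2 d : tree A -> tree B ->
  halfspace H1 -> halfspace H2 -> 0 < d ->
  (forall u v, H1 u -> ~ H2 v -> d <= mdist u v) ->
  (forall e, 0 < e -> forall N : nat, exists2 k : nat, (N <= k)%N &
    hausdorff_dist (iter k f @` A) (iter k f @` B) < e) ->
  exists N : nat, forall k : nat, (N <= k)%N ->
    ~ ((iter k f @` A `&` H1) !=set0 /\ ~ ((iter k f @` B `&` H2) !=set0)).
Proof.
move=> tA tB hH1 hH2 d0 Hd prox.
have [N [p [p0 HQ]]] := evp_and (evp_hits tA hH1) (evp_not (evp_hits tB hH2)).
apply: contrapT => /forallNP H.
have /existsNP[k0 /not_implyP[Nk0 /contrapT Qk0]] := H N.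
have [e e0 He] := iter_unif p d0.
have [k k0k ke] := prox _ e0 k0.
(* The wait from [k] to the next time congruent to [k0] modulo [p]; it is a full period if [k] is
   such a time. *)
pose s := (p - (k - k0) %% p)%N.
have sp : (s <= p)%N by exact: leq_subr.
have ksE : (s + k = k0 + ((k - k0) %/ p).+1 * p)%N.
  have := divn_eq (k - k0) p; have := ltn_pmod (k - k0) p0.
  by rewrite /s mulSn; lia.
have := iffRL (evp_iter ((k - k0) %/ p).+1 HQ Nk0) Qk0.
rewrite -ksE => -[[_ [[a Aa <-] H1a]] nB].
have B0 : (iter k f @` B) !=set0.
  by have [[[[b Bb] _ _] _ _] _] := tB; exists (iter k f b), b.
have [|_ [b Bb <-] ab] := hausdorff_dist_lt cX (a := iter k f a) B0 ke; first by exists a.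
have := He _ sp _ _ ab; rewrite -!iterD.
suff : d <= mdist (iter (s + k) f a) (iter (s + k) f b) by lra.
by apply: Hd => // H2b; apply: nB; exists (iter (s + k) f b); split=> //; exists b.
Qed.

(** Choose the pair for [a] and its gate [b0] to [B]. As [d > 0] puts [H1] inside [H2], a point [b]
    of [B] in [H2] would give a segment from [a] to [b] inside [H2], and this segment contains
    [b0]. *)
Lemma separated_hits (e : R) : 0 < e -> exists (E : {fset X * X})
    (H1 H2 : X * X -> set X),
  [/\ forall i, i \in E -> halfspace (H1 i) /\ halfspace (H2 i),
      exists2 d : R, 0 < d & forall i, i \in E ->
        forall u v, H1 i u -> ~ H2 i v -> d <= mdist u v &
      forall A B, closed B -> connected B -> A !=set0 -> B !=set0 ->
        forall a, A a -> (forall b, B b -> e <= mdist a b) ->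
        exists2 i, i \in E & (A `&` H1 i) !=set0 /\ ~ ((B `&` H2 i) !=set0)].
Proof.
move=> e0; have [E [H1 [H2 [hH [d d0 Hd] HE]]]] := separating_halfspaces dX e0.
exists E, H1, H2; split=> //; first by exists d.
move=> A B clB cB A0 B0 a Aa aB.
have nBa : ~ B a by move=> /aB; rewrite mdistxx; lra.
have [b0 Bb0 Hb0] := gate dX clB cB B0 nBa.
have [i iE [H1a H2b0]] := HE _ _ (aB _ Bb0).
exists i => //; split; first by exists a.
move=> [b [Bb H2b]]; apply: H2b0.
have H2a : H2 i a.
  by apply: contrapT => H2a; have := Hd i iE _ _ H1a H2a; rewrite mdistxx; lra.
by have [_ [cH _]] := hH i iE; exact: (seg_sub cH H2a H2b (Hb0 _ Bb)).
Qed.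

Lemma tree_iter_image A k : tree A -> [/\ (iter k f @` A) !=set0,
  closed (iter k f @` A) & connected (iter k f @` A)].
Proof.
move=> [[[[a Aa] cA conA] _ _] _]; have ck := @iter_continuous _ f k cf.
split; first by exists (iter k f a), a.
  apply: compact_closed; first exact: metric_hausdorff.
  by apply: continuous_compact => //; exact: continuous_subspaceT.
by apply: connected_continuous_connected => //; exact: continuous_subspaceT.
Qed.

(** Each of finitely many pairs of halfspaces eventually stops separating the two orbits; from then
    on their distance is at most [e]. *)
Lemma no_li_yorke_tree A B : tree A -> tree B ->
  ~ li_yorke_pair hausdorff_dist (induced_map f) A B.
Proof.
move=> tA tB [prox]; apply.
pose u k := hausdorff_dist (iter k f @` A) (iter k f @` B).
have uE : (fun k => (hausdorff_dist (iter k (induced_map f) A)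
    (iter k (induced_map f) B))%:E) = (fun k => (u k)%:E).
  by apply/funext => k; rewrite !iter_induced_map.
rewrite /proximal uE in prox; rewrite /asymptotic uE.
have u0 k : 0 <= u k.
  by have [? _ _] := tree_iter_image k tA; have [? _ _] := tree_iter_image k tB;
    exact: hausdorff_dist_ge0.
(* The lower limit is the negated upper limit of the negated sequence; its vanishing gives
   arbitrarily late times with distance below [e]. *)
have Hprox e : 0 < e -> forall N : nat, exists2 k, (N <= k)%N & u k < e.
  move=> e0 N; apply: contrapT => H.
  have : (limn_esup (fun k => - (u k)%:E) <= - e%:E)%E.
    apply: (@le_trans _ _ (ereal_sup [set - (u k)%:E | k in [set k | (N <= k)%N]])%E).
      apply: ereal_inf_lbound; exists [set k | (N <= k)%N] => //.
      by exists N.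
    apply: ge_ereal_sup => _ [k Nk <-]; rewrite leeN2 lee_fin leNgt.
    by apply/negP => uk; apply: H; exists k.
  move: prox; rewrite /limn_einf => /eqP; rewrite oppe_eq0 => /eqP ->.
  by rewrite -EFinN lee_fin; lra.
suff cu : (u k)%:E @[k --> \oo] --> 0%E by have [_ ->] := cvg_limn_einf_sup cu.
apply: cvg_EFin; first by apply: nearW.
apply/cvgrPdist_le => e e0.
have [E [H1 [H2 [hH [d d0 Hd] HE]]]] := separated_hits e0.
have evE A' B' : tree A' -> tree B' -> (forall e, 0 < e -> forall N : nat,
    exists2 k, (N <= k)%N & hausdorff_dist (iter k f @` A') (iter k f @` B') < e) ->
    exists N : nat, forall k : nat, (N <= k)%N -> forall i, i \in enum_fset E ->
      ~ ((iter k f @` A' `&` H1 i) !=set0 /\ ~ ((iter k f @` B' `&` H2 i) !=set0)).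
  move=> tA' tB' prox'.
  have /choice[N HN] : forall i, exists N : nat, i \in E -> forall k : nat, (N <= k)%N ->
      ~ ((iter k f @` A' `&` H1 i) !=set0 /\ ~ ((iter k f @` B' `&` H2 i) !=set0)).
    move=> i; have [iE|_] := boolP (i \in E); last by exists 0%N.
    have [h1 h2] := hH i iE.
    by have [N HN] := proximal_not_separated tA' tB' h1 h2 d0 (Hd i iE) prox'; exists N.
  exists (\max_(i <- enum_fset E) N i)%N => k Nk i iE; apply: HN => //.
  by apply: leq_trans Nk; exact: leq_bigmax_seq.
have [N1 HN1] := evE _ _ tA tB Hprox.
(* The criterion of [separated_hits] is not symmetric, so both orders are treated. *)
have [|N2 HN2] := evE _ _ tB tA.
  by move=> e' e'0 N; have [k Nk uk] := Hprox _ e'0 N; exists k;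
    rewrite // hausdorff_distC.
exists (maxn N1 N2) => // k /=; rewrite geq_max => /andP[Nk1 Nk2].
rewrite sub0r normrN ger0_norm//= leNgt; apply/negP => eu.
have [A0 clA cA] := tree_iter_image k tA; have [B0 clB cB] := tree_iter_image k tB.
have [[a Aa aB]|[b Bb bA]] := hausdorff_dist_gt A0 B0 eu.
  by have [i iE Hi] := HE _ _ clB cB A0 B0 a Aa aB; exact: (HN1 k Nk1 i iE).
by have [i iE Hi] := HE _ _ clA cA B0 A0 b Bb bA; exact: (HN2 k Nk2 i iE).
Qed.

End monotone_dynamics.

(** * Entropy *)

Definition cell_code (T : Type) (hs : seq (set T)) (x : T) : bitseq :=
  [seq `[< h x >] | h <- hs].

Section counting.
Context {R : realType} {X : metricType R}.
Hypothesis dX : dendrite [set: X].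

(* Two cells of the previous halfspaces cannot both be cut by a further one:
   that halfspace and one separating the cells would have four nonempty
   quadrants *)
Lemma halfspace_cells (hs : seq (set X)) : (forall h, h \in hs -> halfspace h) ->
  exists2 C : seq bitseq, (size C <= (size hs).+1)%N &
    forall x, cell_code hs x \in C.
Proof.
elim: hs => [|h hs IH] hH.
  by exists [:: [::]] => // x; rewrite inE.
have [|C sC HC] := IH; first by move=> h' hs'; apply: hH; rewrite inE hs' orbT.
have hh : halfspace h by apply: hH; rewrite inE eqxx.
(* This is the bit of [h] on a cell that [h] does not cut, and true on a cut cell; the cut cell
   therefore contributes one more code, with bit false. *)
pose on c := `[< exists x, cell_code hs x = c /\ h x >].
pose cut c := (exists x, cell_code hs x = c /\ h x) /\
              (exists y, cell_code hs y = c /\ ~ h y).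
have cut_unique c c' : cut c -> cut c' -> c = c'.
  move=> [[x [xc hx]] [y [yc hy]]] [[x' [xc' hx']] [y' [yc' hy']]].
  apply/eqP/negPn/negP => cc'.
  have [k khs kxx'] : exists2 k, k \in hs & `[< k x >] <> `[< k x' >].
    apply: contrapT => H; move/eqP: cc'; apply; rewrite -xc -xc'.
    by apply/eq_in_map => k khs; apply: contrapT => kk; apply: H; exists k.
  have hk : halfspace k by apply: hH; rewrite inE khs orbT.
  have same z w : cell_code hs z = cell_code hs w -> k z <-> k w.
    by move/eq_in_map/(_ k khs) => kzw; rewrite -(asboolE (k z)) kzw asboolE.
  have xy := same x y; rewrite xc yc in xy; have {}xy := xy erefl.
  have xy' := same x' y'; rewrite xc' yc' in xy'; have {}xy' := xy' erefl.
  have [kx|kx] := pselect (k x); have [kx'|kx'] := pselect (k x').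
  - by apply: kxx'; rewrite !asboolT.
  - apply: (halfspace_quadrants dX hh hk hx kx hx' kx' hy' _ hy _); tauto.
  - apply: (halfspace_quadrants dX hh hk hx' kx' hx kx hy _ hy' _); tauto.
  - by apply: kxx'; rewrite !asboolF.
have [[c0 c0P]|nc] := pselect (exists c, cut c).
  exists ((false :: c0) :: [seq on c :: c | c <- C]).
    by rewrite /= size_map.
  move=> x; rewrite inE /=; have [hx|hx] := pselect (h x).
    apply/orP; right; apply/mapP; exists (cell_code hs x) => //.
    by rewrite asboolT//; congr (_ :: _); apply/esym/asboolP; exists x.
  rewrite asboolF//; have [/asboolP ox|nox] := boolP (on (cell_code hs x)).
    by rewrite (cut_unique _ _ (conj ox _) c0P) ?eqxx//; exists x.
  apply/orP; right; apply/mapP; exists (cell_code hs x) => //.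
  by rewrite (negbTE nox).
exists [seq on c :: c | c <- C]; first by rewrite size_map leqW.
move=> x; apply/mapP; exists (cell_code hs x) => //=; congr (_ :: _).
apply/asboolP/asboolP => [hx|ox]; first by exists x.
by apply: contrapT => hx; apply: nc; exists (cell_code hs x); split=> //; exists x.
Qed.

Lemma tree_endpoint (A : set X) : tree A -> endpoint A !=set0.
Proof.
move=> tA; have [[[[a Aa] _ _] _ _] _] := tA.
have hT : halfspace [set: X].
  by split; [have [[]] := dX|rewrite setCT; exact: connected0].
have [|p [pA _]] := endpoint_halfspace dX tA hT; first by exists a.
by exists p.
Qed.

(** Repeating an endpoint pads the list to length exactly [n], so that trees can be coded by
    [n]-tuples of cells. *)
Lemma trees_endpoints n (A : set X) : trees n A -> exists p : 'I_n -> X,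
  forall q, endpoint A q <-> exists i, p i = q.
Proof.
move=> [tA /geq_card_fset_set sn]; have [q0 q0A] := tree_endpoint tA.
have mem q : (q \in fset_set (endpoint A)) <-> endpoint A q.
  by have [_ fA] := tA; rewrite in_fset_set// inE.
exists (fun i => nth q0 (fset_set (endpoint A)) i) => q; split=> [/mem qA|[i <-]].
  have qn : (index q (fset_set (endpoint A)) < n)%N.
    by apply: leq_trans sn; rewrite index_mem.
  by exists (Ordinal qn); rewrite nth_index.
have [iA|iA] := ltnP i (size (fset_set (endpoint A))).
  by apply/mem; exact: mem_nth.
by rewrite nth_default.
Qed.

(** The halfspaces met by a tree are determined by the cells of its endpoints, so coding a tree by
    these [n] cells is injective on [E]. *)
Lemma tree_code_bound n (hs : seq (set X)) (E : {fset set X}) :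
  (forall h, h \in hs -> halfspace h) -> [set` E] `<=` trees n ->
  (forall A B : set X, A \in E -> B \in E ->
    (forall h, h \in hs -> (A `&` h) !=set0 <-> (B `&` h) !=set0) -> A = B) ->
  (#|` E| <= (size hs).+1 ^ n)%N.
Proof.
move=> hH Et inj.
have [C sC HC] := halfspace_cells hH.
have /choice[p Hp] : forall A : set X, exists p : 'I_n -> X, trees n A ->
    forall q, endpoint A q <-> exists i, p i = q.
  move=> A; have [/trees_endpoints[p ?]|nA] := pselect (trees n A); first by exists p.
  have [[x] _ _] : continuum [set: X] by have [] := dX.
  by exists (fun=> x).
have iC x : (index (cell_code hs x) C < size C)%N by rewrite index_mem.
pose phi (A : E) : {ffun 'I_n -> 'I_(size C)} := [ffun i => Ordinal (iC (p (val A) i))].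
have phi_inj : injective phi.
  move=> A B phiAB; apply: val_inj; apply: inj; [exact: valP|exact: valP|].
  have tA := Et _ (valP A); have tB := Et _ (valP B).
  have codeE i : cell_code hs (p (val A) i) = cell_code hs (p (val B) i).
    move/ffunP: phiAB => /(_ i); rewrite !ffunE => -[] /(congr1 (nth [::] C)).
    by rewrite !nth_index.
  have half (A' B' : set X) : trees n A' -> trees n B' ->
      (forall i, cell_code hs (p A' i) = cell_code hs (p B' i)) ->
      forall h, h \in hs -> (A' `&` h) !=set0 -> (B' `&` h) !=set0.
    move=> tA' tB' cE h hhs A'h.
    have [tA'1 _] := tA'.
    have [q [qA hq]] := endpoint_halfspace dX tA'1 (hH h hhs) A'h.
    have [i iq] := iffLR (Hp A' tA' q) qA.
    have [pB _] : endpoint B' (p B' i) by apply/(Hp B' tB'); exists i.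
    exists (p B' i); split=> //; move: (cE i) => /eq_in_map/(_ h hhs) hE.
    by apply/asboolP; rewrite -hE iq; apply/asboolP.
  by move=> h hhs; split; apply: half => // i; rewrite codeE.
rewrite cardfE; apply: leq_trans (leq_card phi phi_inj) _.
by rewrite card_ffun !card_ord; case: n {Et p Hp phi phi_inj} => // n; rewrite leq_exp2r.
Qed.

End counting.

(** One-point trees will bound [sep] below by 1, which makes its logarithm nonnegative. *)
Lemma tree_set1 (R : realType) (X : metricType R) n (x : X) :
  (0 < n)%N -> trees n [set x].
Proof.
move=> n0.
have eS : endpoint [set x] `<=` [set x] by move=> p [].
have e1 : (endpoint [set x] #<= `I_1)%card.
  apply: card_le_trans (subset_card_le eS) _.
  by have := @card_set1 _ x; rewrite card_eq_le => /andP[].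
split; last by apply: card_le_trans e1 _; rewrite card_le_II.
split; last by apply/finite_set_leP; exists 1%N.
split.
- split; [by exists x|exact: compact_set1|exact: connected1].
- move=> _ U -> oU Ux; exists U; split=> //.
  rewrite (_ : _ `&` _ = [set x]); first exact: connected1.
  by apply/seteqP; split=> [y []//|_ ->].
- move=> [S [h [g [_ _ hg _]]] Sx].
  have [|/Sx h1 g1] := hg (1, 0); first by rewrite /unit_circle/= expr1n expr0n addr0.
  have [|/Sx h2 g2] := hg (-1, 0); first by rewrite /unit_circle/= sqrrN expr1n expr0n addr0.
  by move: g1 g2; rewrite h1 h2 => -> [] ; lra.
Qed.

Lemma ln_poly_sublinear (R : realType) (N n : nat) (eta : R) : 0 < eta ->
  exists M : nat, forall m : nat, (M <= m)%N ->
    m%:R^-1 * ln ((((m * N).+1 ^ n)%N)%:R : R) <= eta.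
Proof.
(* With [K <= m * N.+1] and [ln K <= 2 * Num.sqrt K], it suffices that
   [2 * n * Num.sqrt K <= eta * m]; squaring turns this into [c <= eta ^+ 2 * m]. *)
move=> eta0; pose c : R := (2 * n%:R) ^+ 2 * (N.+1)%:R.
have [M0 HM0] : exists M0 : nat, c / eta ^+ 2 < M0%:R.
  by exists (Num.truncn (c / eta ^+ 2)).+1; exact: truncnS_gt.
exists M0.+1 => m Mm.
have m0 : (0 : R) < m%:R by rewrite ltr0n; lia.
rewrite mulrC ler_pdivrMr// natrX lnXn ?ltr0n//.
set K : R := (m * N).+1%:R.
have K0 : 0 < K by rewrite ltr0n.
have sK : Num.sqrt K ^+ 2 = K by rewrite sqr_sqrtr// ltW.
have sK0 : 0 < Num.sqrt K by rewrite sqrtr_gt0.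
have lnK : ln K <= 2 * Num.sqrt K.
  by rewrite -{1}sK lnXn// mulr2n; have := ln_sublinear sK0; lra.
have KN : K <= m%:R * N.+1%:R.
  by rewrite -natrM ler_nat; nia.
have cm : c <= eta ^+ 2 * m%:R.
  rewrite mulrC -ler_pdivrMr ?exprn_gt0//; apply: le_trans (ltW HM0) _.
  by rewrite ler_nat ltnW.
apply: le_trans (_ : 2 * n%:R * Num.sqrt K <= _).
  by rewrite -[ln K *+ n]mulr_natl -[leRHS]mulrA mulrCA ler_wpM2l.
rewrite -ler_sqr ?nnegrE ?mulr_ge0 ?(ltW sK0) ?(ltW eta0)// exprMn sK.
apply: le_trans (_ : (2 * n%:R) ^+ 2 * (m%:R * N.+1%:R) <= _).
  by rewrite ler_wpM2l ?sqr_ge0.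
rewrite mulrCA -/c exprMn [m%:R ^+ 2]expr2 [leRHS]mulrCA.
by rewrite ler_wpM2l// ltW.
Qed.

Section tree_entropy.
Context {R : realType} {X : metricType R}.
Hypothesis dX : dendrite [set: X].
Variable f : X -> X.
Hypothesis cf : continuous f.
Hypothesis mf : monotone_map f.

(** Pull the finitely many [H1 i] back along the first [m] iterates: trees meeting the same ones of
    these halfspaces cannot be separated within [m] steps. Their number is linear in [m], so
    [tree_code_bound] gives a polynomial bound. *)
Lemma sep_trees_le n (e : R) : 0 < e -> exists N : nat, forall m : nat,
  (sep hausdorff_dist (induced_map f) (trees n) m e <=
    (((m * N).+1 ^ n)%N%:R)%:E)%E.
Proof.
move=> e0; have [E0 [H1 [H2 [hH [d d0 Hd] HE]]]] := separated_hits dX e0.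
exists (size (enum_fset E0)) => m; apply: ge_ereal_sup => _ [E [Et Es] <-].
rewrite lee_fin ler_nat.
pose hs := [seq iter j f @^-1` H1 i | j <- iota 0 m, i <- enum_fset E0].
have -> : (m * size (enum_fset E0))%N = size hs by rewrite size_allpairs size_iota.
apply: (tree_code_bound dX) => //.
  move=> _ /allpairsP[[j i] /= [_ iE ->]]; apply: (halfspace_preimage_iter mf).
  by have [] := hH i iE.
(* The preimages of the [H1 i] suffice, because [H1 i] lies in [H2 i]. *)
have half (A B : set X) j i : (j < m)%N -> i \in E0 ->
    (forall h, h \in hs -> (A `&` h) !=set0 -> (B `&` h) !=set0) ->
    (iter j f @` A `&` H1 i) !=set0 -> (iter j f @` B `&` H2 i) !=set0.
  move=> jm iE AB [_ [[a Aa <-] Ha]].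
  have [||b [Bb Hb]] := AB (iter j f @^-1` H1 i); last 1 first.
  - exists (iter j f b); split; first by exists b.
    apply: contrapT => H2b; have := Hd i iE _ _ Hb H2b.
    by rewrite mdistxx; lra.
  - by apply/allpairsP; exists (j, i); rewrite /= mem_iota.
  - by exists a.
move=> A B AE BE AB; apply: contrapT => nAB.
have [j jm] := Es _ _ AE BE nAB; rewrite !iter_induced_map => eAB.
have [tA _] := Et _ AE; have [tB _] := Et _ BE.
have [A0 clA cA] := tree_iter_image cf j tA.
have [B0 clB cB] := tree_iter_image cf j tB.
have [[a Aa aB]|[b Bb bA]] := hausdorff_dist_gt A0 B0 eAB.
  have [i iE [h nh]] := HE _ _ clB cB A0 B0 a Aa aB.
  by apply: nh; apply: half h => // k /AB[].
have [i iE [h nh]] := HE _ _ clA cA B0 A0 b Bb bA.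
by apply: nh; apply: half h => // k /AB[].
Qed.

Lemma sep_trees_ge1 n m (e : R) : (0 < n)%N ->
  (1 <= sep hausdorff_dist (induced_map f) (trees n) m e)%E.
Proof.
move=> n0; have [[x _] _ _] : continuum [set: X] by have [] := dX.
apply: ereal_sup_ubound; exists [fset [set x]]%fset; last by rewrite cardfs1.
split=> [A /= /fset1P ->|A B /fset1P -> /fset1P ->//]; exact: tree_set1.
Qed.

Lemma entropy_at_trees n (e : R) : (0 < n)%N -> 0 < e ->
  entropy_at hausdorff_dist (induced_map f) (trees n) e = 0%E.
Proof.
move=> n0 e0; have [N HN] := sep_trees_le n e0.
pose r m : R := fine (sep hausdorff_dist (induced_map f) (trees n) m e).
have rE m : sep hausdorff_dist (induced_map f) (trees n) m e = (r m)%:E.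
  rewrite fineK// fin_numElt; apply/andP; split.
    by apply: lt_le_trans (sep_trees_ge1 m e n0); rewrite ltNyr.
  by apply: le_lt_trans (HN m) _; rewrite ltry.
have r1 m : 1 <= r m by rewrite -lee_fin -rE; exact: sep_trees_ge1.
have rN m : r m <= ((m * N).+1 ^ n)%N%:R by rewrite -lee_fin -rE.
have r0 m : 0 < r m by apply: lt_le_trans (r1 m).
rewrite /entropy_at (_ : (fun m => _) = fun m => (m%:R^-1 * ln (r m))%:E); last first.
  by apply/funext => m; rewrite rE lne_EFin.
suff cu : (m%:R^-1 * ln (r m))%:E @[m --> \oo] --> 0%E.
  by have [_ ->] := cvg_limn_einf_sup cu.
apply: cvg_EFin; first by apply: nearW.
apply/cvgrPdist_le => eta eta0.
have [M HM] := ln_poly_sublinear N n eta0.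
exists M => // m /= Mm; rewrite sub0r normrN ger0_norm.
  apply: le_trans (HM m Mm); rewrite ler_wpM2l ?invr_ge0//.
  by rewrite ler_ln ?posrE// ltr0n expn_gt0.
by rewrite mulr_ge0 ?invr_ge0// ln_ge0.
Qed.

Lemma topological_entropy_trees n : (0 < n)%N ->
  topological_entropy hausdorff_dist (induced_map f) (trees n) = 0%E.
Proof.
move=> n0; apply: cvg_lim => //; apply: cvg_near_cst.
near=> e; apply: entropy_at_trees => //.
Unshelve. all: by end_near. Qed.

End tree_entropy.

Theorem corollary6p6 (R : realType) (X : metricType R) (f : X -> X) (n : nat) :
  dendrite [set: X] ->
  continuous f ->
  monotone_map f ->
  (0 < n)%N ->
  (forall A B : set X, trees n A -> trees n B ->
    ~ li_yorke_pair hausdorff_dist (induced_map f) A B) /\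
  topological_entropy hausdorff_dist (induced_map f) (trees n) = 0%E.
Proof.
move=> dX cf mf n0; split; last exact: topological_entropy_trees.
by move=> A B [tA _] [tB _]; exact: no_li_yorke_tree.
Qed.
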